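(* Let $(X,\xi)$ be a weak $\omega$-category and let $I\subseteq \coprod_{n\in\mathbb{N}}X_n$ be the set of all invertible cells in $X$. Then $\operatorname{pst}(I)\subseteq I$. (Here $\operatorname{pst}(I)$ is the set of all cells of the form $\xi(\phi,\boldsymbol{u})$ with $n\ge 0$ and $(\phi,\boldsymbol{u})\in(LX)_n$ such that every $n$-cell of $X$ appearing in the top row of the $n$-dimensional pasting diagram $\boldsymbol{u}$ belongs to $I$.)
   Context: **Globular sets.** A globular set $X$ consists of sets $X_n$ ($n\ge 0$), whose elements are called $n$-cells, and maps $s^X_n,t^X_n\colon X_{n+1}\to X_n$ with $s_n^Xs_{n+1}^X=s_n^Xt_{n+1}^X$ and $t_n^Xs_{n+1}^X=t_n^Xt_{n+1}^X$ (equivalently, a presheaf on the globe category). Morphisms commute with all $s,t$; the category is $\mathbf{GSet}$. For $m<n$, $s^X_m,t^X_m\colon X_n\to X_m$ denote the iterated source and target maps. Two $n$-cells are parallel if $n=0$, or $n\ge 1$ and they have the same $s^X_{n-1}$ and the same $t^X_{n-1}$. For $n\ge1$ and an $n$-cell $u$, $u\colon x\to y$ means $s^X_{n-1}(u)=x$, $t^X_{n-1}(u)=y$. $G^n$ is the representable globular set, so morphisms $G^n\to X$ correspond to $n$-cells of $X$; $\iota_n\colon\partial G^n\to G^n$ is the inclusion of the largest proper globular subset. For $n\ge 1$, morphisms $\partial G^n\to X$ correspond to parallel pairs $(u,v)$ of $(n-1)$-cells; the corresponding morphism is written $\langle u,v\rangle$. $1$ is the terminal globular set. **The monad $T$.**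 $T=(T,\eta^T,\mu^T)$ is the monad on $\mathbf{GSet}$ induced by the monadic forgetful functor from small strict $\omega$-categories and strict $\omega$-functors. It is described as follows. A pasting scheme of rank $r\ge0$ is a table of non-negative integers $\boldsymbol{k}=\begin{bmatrix}k_0&&k_1&&\dots&&k_r\\&\underline{k}_1&&\underline{k}_2&\dots&\underline{k}_r&\end{bmatrix}$ with $k_{i-1}>\underline k_i<k_i$ for $1\le i\le r$; it is of dimension $n$ if $k_i\le n$ for all $i$. A pasting diagram of shape $\boldsymbol k$ in $X$ is a table $\boldsymbol{u}=\begin{bmatrix}u_0&&u_1&&\dots&&u_r\\&\underline{u}_1&&\underline{u}_2&\dots&\underline{u}_r&\end{bmatrix}$ with $u_i\in X_{k_i}$, $\underline u_i\in X_{\underline k_i}$ and $t^X_{\underline k_i}(u_{i-1})=\underline u_i=s^X_{\underline k_i}(u_i)$ for $1\le i\le r$. Then $(TX)_n$ is the set of pasting diagrams in $X$ of dimension $n$ (i.e. whose shape is of dimension $n$); in particular $(T1)_n$ is the set of pasting schemes of dimension $n$, $T!\colon TX\to T1$ sends a diagram to its shape, and $Tf$ applies $f$ entrywise. When a scheme or diagram is regarded as an $n$-cell we may write a superscript $(n)$. An $n$-cell $\boldsymbol k$ of $T1$ is degenerate if $\max_i k_i<n$. For $m<n$, an $m$-transversal component of $\boldsymbol k$ is given by indices $0\le i\le j\le r$ such that $k_l>m$ for $i\le l\le j$, $\underline k_l\ge m$ for $i+1\le l\le j$, either $i=0$ or $\underline k_i<m$, and either $j=r$ or $\underline k_{j+1}<m$.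 $s^{TX}_m(\boldsymbol u)$ (resp. $t^{TX}_m(\boldsymbol u)$) is obtained from $\boldsymbol u$ by replacing, for each $m$-transversal component $i\le j$, the segment $u_i,\underline u_{i+1},\dots,\underline u_j,u_j$ by the single top-row entry $s^X_m(u_i)$ (resp. $t^X_m(u_j)$). The unit sends $x\in X_n$ to the one-entry diagram $[x]$ (so $\eta^T_1$ picks out $[n]\in(T1)_n$), and $\mu^T_X$ glues a pasting diagram of pasting diagrams together. **Weak $\omega$-categories (Leinster).** $T$ is a cartesian monad. A cartesian monad over $T$ with contraction is a monad $P$ on $\mathbf{GSet}$ with a monad morphism $\mathrm{ar}^P\colon P\to T$ all of whose naturality squares are pullbacks, together with a function $\kappa^P$ assigning to each $n\ge1$, $u\colon\partial G^n\to P1$, $v\colon G^n\to T1$ with $\mathrm{ar}^P_1\circ u=v\circ\iota_n$ a morphism $\kappa^P(u,v)\colon G^n\to P1$ with $\kappa^P(u,v)\circ\iota_n=u$ and $\mathrm{ar}^P_1\circ\kappa^P(u,v)=v$. Morphisms are monad morphisms $\alpha\colon P\to Q$ with $\mathrm{ar}^Q\circ\alpha=\mathrm{ar}^P$ and $\alpha_1\circ\kappa^P(u,v)=\kappa^Q(\alpha_1\circ u,v)$. This category has an initial object $(L,\mathrm{ar}^L,\kappa^L)$; write $\mathrm{ar}_X=\mathrm{ar}^L_X$, $\mathrm{ar}=\mathrm{ar}^L_1\colon L1\to T1$, $\kappa=\kappa^L$. A weak $\omega$-category is an Eilenberg–Moore algebra $(X,\xi\colon LX\to X)$ of the monad $L$;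 a strict $\omega$-functor is a morphism of $L$-algebras. Since $LX$ is the pullback of $T!\colon TX\to T1$ and $\mathrm{ar}$, an $n$-cell of $LX$ is a pair $(\phi,\boldsymbol u)$ with $\phi\in(L1)_n$ and $\boldsymbol u\in(TX)_n$ of shape $\mathrm{ar}(\phi)$, with sources and targets taken componentwise. For parallel $\phi,\phi'\in(L1)_{n-1}$ and $\boldsymbol k\in(T1)_n$ with $\mathrm{ar}(\phi)=s^{T1}_{n-1}(\boldsymbol k)=t^{T1}_{n-1}(\boldsymbol k)=\mathrm{ar}(\phi')$, $\kappa(\langle\phi,\phi'\rangle,\boldsymbol k)\in(L1)_n$ is a cell $\phi\to\phi'$ of arity $\boldsymbol k$. **Identities and composition.** Let $\widetilde e_n\in(L1)_n$ be the image under $\eta^L_1$ of the unique $n$-cell of $1$. The standard pasting instruction $\mathrm{sp}(\boldsymbol k)\in(L1)_n$ of $\boldsymbol k\in(T1)_n$ is defined inductively on $n$: $\mathrm{sp}([n])=\widetilde e_n$, and otherwise $\mathrm{sp}(\boldsymbol k)=\kappa(\langle\mathrm{sp}(\boldsymbol k'),\mathrm{sp}(\boldsymbol k')\rangle,\boldsymbol k)$ where $\boldsymbol k'=s^{T1}_{n-1}(\boldsymbol k)=t^{T1}_{n-1}(\boldsymbol k)$. In a weak $\omega$-category $(X,\xi)$ and for $n\ge1$: for $x\in X_{n-1}$ put $\mathrm{id}_n(x)=\xi(\mathrm{sp}([n-1]^{(n)}),[x])$, an $n$-cell $x\to x$; for $n$-cells $u\colon x\to y$, $v\colon y\to z$ put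 $u\ast_{n-1}v=\xi\Bigl(\mathrm{sp}\Bigl(\begin{bmatrix}n&&n\\&n-1&\end{bmatrix}\Bigr),\begin{bmatrix}u&&v\\&y&\end{bmatrix}\Bigr)$, an $n$-cell $x\to z$. **Invertible cells.** Invertible means weakly invertible, defined coinductively. For $S\subseteq\coprod_nX_n$ let $\Phi^X(S)$ be the set of all cells $u\colon x\to y$ of dimension $n\ge1$ for which there exist an $n$-cell $v\colon y\to x$ and $(n+1)$-cells $p\colon u\ast_{n-1}v\to\mathrm{id}_n(x)$ and $q\colon v\ast_{n-1}u\to\mathrm{id}_n(y)$ in $S$. The set of invertible cells of $X$ is the greatest fixed point (equivalently, the greatest $W$ with $W\subseteq\Phi^X(W)$) of the monotone map $\Phi^X$. An inverse of an $n$-cell $u\colon x\to y$ is an $n$-cell $v\colon y\to x$ for which there are invertible $(n+1)$-cells $u\ast_{n-1}v\to\mathrm{id}_n(x)$ and $v\ast_{n-1}u\to\mathrm{id}_n(y)$. For $n$-cells $x,y$ ($n\ge0$), $x\sim y$ means that there is an invertible $(n+1)$-cell $x\to y$. **Labelled pastings.** For a pasting diagram $\boldsymbol u\in(TX)_n$ of shape $\boldsymbol k$ and rank $r$, put $\mathrm{fdl}(\boldsymbol u)=\{u_i\mid 0\le i\le r,\ k_i=n\}\subseteq X_n$. For a set $S$ of cells of a weak $\omega$-category $(X,\xi)$ (that is, $S_n\subseteq X_n$ for each $n\ge0$, with no conditions), $\operatorname{pst}(S)=\{\xi(\phi,\boldsymbol u)\mid n\ge0,\ (\phi,\boldsymbol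 u)\in(LX)_n,\ \mathrm{fdl}(\boldsymbol u)\subseteq S\}$. *)

(* Defs.v *)
From mathcomp Require Import all_boot.
From mathcomp Require Import boolp zify.

Set Implicit Arguments.
Unset Strict Implicit.
Unset Printing Implicit Defensive.
#[local] Obligation Tactic := idtac.

Record gset : Type := GSet {
  cells :> nat -> Type;
  src : forall n, cells n.+1 -> cells n;
  tgt : forall n, cells n.+1 -> cells n;
  src_src : forall n (x : cells n.+2), src (src x) = src (tgt x);
  tgt_src : forall n (x : cells n.+2), tgt (src x) = tgt (tgt x) }.
Arguments src {g n} x.
Arguments tgt {g n} x.

Record gmap (X Y : gset) : Type := GMap {
  gfun :> forall n, X n -> Y n;
  gfun_src : forall n (x : X n.+1), gfun (src x) = src (gfun x);
  gfun_tgt : forall n (x : X n.+1), gfun (tgt x) = tgt (gfun x) }.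
Arguments gfun {X Y} g {n} x : rename.

Lemma gmapP (X Y : gset) (f g : gmap X Y) :
  (forall n (x : X n), f n x = g n x) -> f = g.
Proof.
case: f g => [f fs ft] [g gs gt] /= fg.
have E : f = g by apply: functional_extensionality_dep => n; exact: funext.
by case: g / E gs gt {fg} => gs gt; congr GMap; exact: Prop_irrelevance.
Qed.

Definition gid (X : gset) : gmap X X :=
  @GMap X X (fun _ x => x) (fun _ _ => erefl) (fun _ _ => erefl).

Program Definition gcomp (X Y Z : gset) (g : gmap Y Z) (f : gmap X Y) :
    gmap X Z := @GMap X Z (fun n x => g n (f n x)) _ _.
Next Obligation. by move=> X Y Z g f n x; rewrite /= !gfun_src. Qed.
Next Obligation. by move=> X Y Z g f n x; rewrite /= !gfun_tgt. Qed.

Notation "g \og f" := (gcomp g f) (at level 50, left associativity).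

Definition gterm : gset :=
  @GSet (fun _ => unit) (fun _ _ => tt) (fun _ _ => tt)
    (fun _ _ => erefl) (fun _ _ => erefl).

Definition bang (X : gset) : gmap X gterm :=
  @GMap X gterm (fun _ _ => tt) (fun _ _ => erefl) (fun _ _ => erefl).

Definition parallel (X : gset) (n : nat) : X n -> X n -> Prop :=
  match n with
  | 0 => fun _ _ => True
  | n'.+1 => fun x y => src x = src y /\ tgt x = tgt y
  end.

Definition is_pullback (W X Y Z : gset) (p : gmap W X) (q : gmap W Y)
    (f : gmap X Z) (g : gmap Y Z) : Prop :=
  f \og p = g \og q /\
  forall (V : gset) (a : gmap V X) (b : gmap V Y), f \og a = g \og b ->
    exists! h : gmap V W, p \og h = a /\ q \og h = b.

Definition anycell (X : gset) := {n : nat & X n}.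
Definition acell (X : gset) n (x : X n) : anycell X := existT (cells X) n x.
Definition adim (X : gset) (c : anycell X) : nat := projT1 c.

Definition asrc1 (X : gset) (c : anycell X) : anycell X :=
  match c with existT n x =>
    match n return X n -> anycell X with
    | 0 => fun x => acell x
    | n'.+1 => fun x => acell (src x)
    end x
  end.
Definition atgt1 (X : gset) (c : anycell X) : anycell X :=
  match c with existT n x =>
    match n return X n -> anycell X with
    | 0 => fun x => acell x
    | n'.+1 => fun x => acell (tgt x)
    end x
  end.

(* The iterated source and target in dimension m; a cell of dimension at
   most m is left unchanged. *)
Definition asrc (X : gset) m (c : anycell X) := iter (adim c - m) (@asrc1 X) c.
Definition atgt (X : gset) m (c : anycell X) := iter (adim c - m) (@atgt1 X) c.

Definition amap (X Y : gset) (f : gmap X Y) (c : anycell X) : anycell Y :=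
  acell (f _ (projT2 c)).

Section AnyCell.
Variable X : gset.
Implicit Types (c : anycell X) (m k : nat).

Lemma adim_src1 c : adim (asrc1 c) = (adim c).-1.
Proof. by case: c => -[|n] x. Qed.
Lemma adim_tgt1 c : adim (atgt1 c) = (adim c).-1.
Proof. by case: c => -[|n] x. Qed.

Lemma adim_iter_src1 i c : adim (iter i (@asrc1 X) c) = adim c - i.
Proof. by elim: i => [|i IH]; rewrite ?subn0 // iterS adim_src1 IH subnS. Qed.
Lemma adim_iter_tgt1 i c : adim (iter i (@atgt1 X) c) = adim c - i.
Proof. by elim: i => [|i IH]; rewrite ?subn0 // iterS adim_tgt1 IH subnS. Qed.

Lemma adim_src m c : adim (asrc m c) = minn (adim c) m.
Proof. by rewrite /asrc adim_iter_src1; rewrite minnE. Qed.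
Lemma adim_tgt m c : adim (atgt m c) = minn (adim c) m.
Proof. by rewrite /atgt adim_iter_tgt1; rewrite minnE. Qed.

Lemma asrc_id m c : adim c <= m -> asrc m c = c.
Proof. by rewrite /asrc -subn_eq0 => /eqP->. Qed.
Lemma atgt_id m c : adim c <= m -> atgt m c = c.
Proof. by rewrite /atgt -subn_eq0 => /eqP->. Qed.

Lemma asrc_src m k c : m <= k -> asrc m (asrc k c) = asrc m c.
Proof.
move=> mk; rewrite {1}/asrc adim_src {1}/asrc -iterD /asrc; congr iter.
by rewrite minnE; lia.
Qed.
Lemma atgt_tgt m k c : m <= k -> atgt m (atgt k c) = atgt m c.
Proof.
move=> mk; rewrite {1}/atgt adim_tgt {1}/atgt -iterD /atgt; congr iter.
by rewrite minnE; lia.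
Qed.

Lemma asrc1_tgt1 c : 1 < adim c -> asrc1 (atgt1 c) = asrc1 (asrc1 c).
Proof. by case: c => -[|[|n]] x //= _; rewrite -src_src. Qed.
Lemma atgt1_src1 c : 1 < adim c -> atgt1 (asrc1 c) = atgt1 (atgt1 c).
Proof. by case: c => -[|[|n]] x //= _; rewrite tgt_src. Qed.

Lemma iter_src1_tgt1 i j c :
  i + j.+1 <= adim c -> iter j.+1 (@asrc1 X) (iter i (@atgt1 X) c) =
                        iter (i + j.+1) (@asrc1 X) c.
Proof.
elim: i j => [|i IH] j // le.
rewrite iterSr iterS asrc1_tgt1 ?adim_iter_tgt1; last by lia.
by rewrite -!iterSr IH; [congr iter; lia | lia].
Qed.
Lemma iter_tgt1_src1 i j c :
  i + j.+1 <= adim c -> iter j.+1 (@atgt1 X) (iter i (@asrc1 X) c) =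
                        iter (i + j.+1) (@atgt1 X) c.
Proof.
elim: i j => [|i IH] j // le.
rewrite iterSr iterS atgt1_src1 ?adim_iter_src1; last by lia.
by rewrite -!iterSr IH; [congr iter; lia | lia].
Qed.

Lemma asrc_tgt m k c : m < k -> asrc m (atgt k c) = asrc m c.
Proof.
move=> mk; case: (leqP (adim c) k) => [le|lt]; first by rewrite (atgt_id le).
rewrite /asrc adim_tgt (minn_idPr (ltnW lt)) /atgt.
rewrite (_ : k - m = (k - m).-1.+1); last by lia.
by rewrite iter_src1_tgt1; [congr iter; lia | lia].
Qed.
Lemma atgt_src m k c : m < k -> atgt m (asrc k c) = atgt m c.
Proof.
move=> mk; case: (leqP (adim c) k) => [le|lt]; first by rewrite (asrc_id le).
rewrite /atgt adim_src (minn_idPr (ltnW lt)) /asrc.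
rewrite (_ : k - m = (k - m).-1.+1); last by lia.
by rewrite iter_tgt1_src1; [congr iter; lia | lia].
Qed.
End AnyCell.

Lemma adim_map (X Y : gset) (f : gmap X Y) c : adim (amap f c) = adim c.
Proof. by []. Qed.
Lemma asrc_map (X Y : gset) (f : gmap X Y) m c :
  asrc m (amap f c) = amap f (asrc m c).
Proof.
rewrite /asrc adim_map; elim: (adim c - m) => //= i ->.
by case: (iter _ _ _) => -[|n] x //=; rewrite /amap /acell /= gfun_src.
Qed.
Lemma atgt_map (X Y : gset) (f : gmap X Y) m c :
  atgt m (amap f c) = amap f (atgt m c).
Proof.
rewrite /atgt adim_map; elim: (adim c - m) => //= i ->.
by case: (iter _ _ _) => -[|n] x //=; rewrite /amap /acell /= gfun_tgt.
Qed.

(* [(e_0, [:: (s_1, e_1); ...; (s_r, e_r)])] is the table with top row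
   e_0, ..., e_r and bottom row s_1, ..., s_r. *)
Definition table (S E : Type) := (E * seq (S * E))%type.

Definition tops S E (u : table S E) : seq E := u.1 :: [seq p.2 | p <- u.2].
Definition tfirst S E (u : table S E) : E := u.1.
Definition tlast S E (u : table S E) : E := last u.1 [seq p.2 | p <- u.2].
Definition tmap S S' E E' (f : S -> S') (g : E -> E') (u : table S E) :
  table S' E' := (g u.1, [seq (f p.1, g p.2) | p <- u.2]).
Definition tcat S E (u : table S E) (s : S) (v : table S E) : table S E :=
  (u.1, u.2 ++ (s, v.1) :: v.2).

(* R holds for any two consecutive top entries and the bottom entry between
   them. *)
Fixpoint tlinked_rec S E (R : E -> S -> E -> Prop) (e : E) (l : seq (S * E)) :=
  match l with
  | [::] => True
  | (s, e') :: l' => R e s e' /\ tlinked_rec R e' l'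
  end.
Definition tlinked S E (R : E -> S -> E -> Prop) (u : table S E) :=
  tlinked_rec R u.1 u.2.

(* The table of tables obtained by cutting at the bottom entries satisfying b *)
Fixpoint tcut_rec S E (b : S -> bool) (e : E) (l : seq (S * E)) :
    table S (table S E) :=
  match l with
  | [::] => ((e, [::]), [::])
  | (s, e') :: l' => let z := tcut_rec b e' l' in
      if b s then ((e, [::]), (s, z.1) :: z.2) else (tcat (e, [::]) s z.1, z.2)
  end.
Definition tcut S E (b : S -> bool) (u : table S E) := tcut_rec b u.1 u.2.

Definition tflatten S E (z : table S (table S E)) : table S E :=
  (z.1.1, z.1.2 ++ flatten [seq (p.1, p.2.1) :: p.2.2 | p <- z.2]).

Definition tzip S E E' E'' (f : E -> E' -> E'') (u : table S E) (v : table S E') :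
    table S E'' :=
  (f u.1 v.1, [seq (p.1.1, f p.1.2 p.2.2) | p <- zip u.2 v.2]).

Fixpoint tfold_rec S E (f : E -> E -> E) (e : E) (l : seq (S * E)) : E :=
  match l with
  | [::] => e
  | p :: l' => f e (tfold_rec f p.2 l')
  end.
Definition tfold S E (f : E -> E -> E) (u : table S E) : E := tfold_rec f u.1 u.2.

Section Diagrams.
Variable X : gset.
Definition atable := table (anycell X) (anycell X).

Definition pd_link (a b c : anycell X) : Prop :=
  [/\ adim b < adim a, adim b < adim c, atgt (adim b) a = b & asrc (adim b) c = b].

Definition is_pd (n : nat) (u : atable) : Prop :=
  tlinked pd_link u /\ all (fun c => adim c <= n) (tops u).

(* Cutting a diagram at its bottom entries of dimension < m yields its
   m-transversal components, together with one-entry tables holding the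
   remaining top entries, which have dimension at most m. *)
Definition pd_blocks m (u : atable) := tcut (fun b => adim b < m) u.

Definition pd_src m (u : atable) : atable :=
  tmap id (fun w => asrc m (tfirst w)) (pd_blocks m u).
Definition pd_tgt m (u : atable) : atable :=
  tmap id (fun w => atgt m (tlast w)) (pd_blocks m u).

(* The composite along dimension m of two tables obtained by cutting at the
   bottom entries of dimension < m, where the target of u and the source of v
   in dimension m agree.  A table whose first entry has dimension at most m
   has no other entry and is an identity for this composition. *)
Definition pd_join m (u v : atable) : atable :=
  if adim (tfirst u) <= m then v else
  if adim (tfirst v) <= m then u else
  tcat u (atgt m (tlast u)) v.

(* The composite along dimension m of two pasting diagrams u and v such that
   pd_tgt m u = pd_src m v, in the free strict omega-category. *)
Definition pd_comp m (u v : atable) : atable :=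
  tflatten (tzip (pd_join m) (pd_blocks m u) (pd_blocks m v)).

(* The gluing of a table of pasting diagrams whose bottom entries, of which
   only the dimensions are recorded, lie in the interval [m, m + d): the entries
   on both sides of a bottom entry of dimension i are composed along
   dimension i, higher dimensions first. *)
Fixpoint pd_glue (d m : nat) (U : table nat atable) : atable :=
  match d with
  | 0 => U.1
  | d'.+1 => tfold (pd_comp m)
      (tmap id (pd_glue d' m.+1) (tcut (fun i => i < m.+1) U))
  end.
End Diagrams.

Section TableTheory.
Variables S E : Type.
Implicit Types (u v w : table S E) (s : S) (b : S -> bool).

Lemma tcat1 e s v : tcat (e, [::]) s v = (e, (s, v.1) :: v.2) :> table S E.
Proof. by []. Qed.

Lemma tcatA u s v s' w : tcat (tcat u s v) s' w = tcat u s (tcat v s' w).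
Proof. by rewrite /tcat /= -catA. Qed.

Lemma tfirst_cat u s v : tfirst (tcat u s v) = tfirst u. Proof. by []. Qed.
Lemma tlast_cat u s v : tlast (tcat u s v) = tlast v.
Proof. by rewrite /tlast /= map_cat last_cat. Qed.

Lemma tops_cat u s v : tops (tcat u s v) = tops u ++ tops v.
Proof. by rewrite /tops /= map_cat. Qed.

Lemma tmap_cat S' E' (f : S -> S') (g : E -> E') u s v :
  tmap f g (tcat u s v) = tcat (tmap f g u) (f s) (tmap f g v).
Proof. by rewrite /tmap /tcat /= map_cat. Qed.

Lemma tlinked_cat (R : E -> S -> E -> Prop) u s v :
  tlinked R (tcat u s v) <-> [/\ tlinked R u, R (tlast u) s (tfirst v) & tlinked R v].
Proof.
case: u => a l; rewrite /tlinked /tcat /tlast /=.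
elim: l a => [|[s' a'] l IH] a /=; first by split=> [[]|[]].
by rewrite IH; split=> [[? []]|[[]]].
Qed.

Lemma tcut_cons b e s (v : table S E) : tcut b (e, (s, v.1) :: v.2) =
  if b s then tcat ((e, [::]), [::]) s (tcut b v)
  else (tcat (e, [::]) s (tcut b v).1, (tcut b v).2).
Proof. by case: v => e' l; rewrite /tcut /=; case: (b s). Qed.

Lemma tcut_cat b u s v :
  b s -> tcut b (tcat u s v) = tcat (tcut b u) s (tcut b v).
Proof.
move=> bs; case: u => a l; elim: l a => [|[s' a'] l IH] a.
  by rewrite tcat1 tcut_cons bs.
have -> : tcat (a, (s', a') :: l) s v = tcat (a, [::]) s' (tcat (a', l) s v) by [].
rewrite tcat1 tcut_cons IH.
have -> : (a, (s', a') :: l) = (a, (s', (a', l).1) :: (a', l).2) by [].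
by rewrite tcut_cons; case: (b s').
Qed.

Lemma tcut_solid b u : all (fun p => ~~ b p.1) u.2 -> tcut b u = (u, [::]).
Proof.
case: u => a l; elim: l a => [|[s a'] l IH] a //= /andP[bs al].
have -> : (a, (s, a') :: l) = (a, (s, (a', l).1) :: (a', l).2) by [].
by rewrite tcut_cons (negbTE bs) IH.
Qed.

Lemma tflatten_cat (z : table S (table S E)) s z' :
  tflatten (tcat z s z') = tcat (tflatten z) s (tflatten z').
Proof. by rewrite /tflatten /tcat /= map_cat flatten_cat /= -!catA. Qed.

Lemma tcat1_inj e s v e' s' v' : tcat (e, [::]) s v = tcat (e', [::]) s' v' ->
  [/\ e = e', s = s' & v = v'].
Proof. by case: v v' => [a l] [a' l'] [-> -> -> ->]. Qed.

Lemma tfold_cat1 (f : E -> E -> E) e s v :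
  tfold f (tcat (e, [::]) s v) = f e (tfold f v).
Proof. by []. Qed.

Lemma table_ind (P : table S E -> Prop) : (forall e, P (e, [::])) ->
  (forall e s v, P v -> P (tcat (e, [::]) s v)) -> forall u, P u.
Proof.
move=> P1 PS [e l]; elim: l e => [|[s e'] l IH] e; first exact: P1.
exact: (PS e s (e', l)).
Qed.
End TableTheory.

Lemma tzip_cat S E E' E'' (f : E -> E' -> E'') (z : table S E) s z'
    (w : table S E') s' w' :
  size z.2 = size w.2 ->
  tzip f (tcat z s z') (tcat w s' w') = tcat (tzip f z w) s (tzip f z' w').
Proof. by move=> zw; rewrite /tzip /tcat /= zip_cat // map_cat. Qed.

Lemma tcut_map S E S' E' (f : S -> S') (g : E -> E') (b : S' -> bool) (u : table S E) :
  tcut b (tmap f g u) = tmap f (tmap f g) (tcut (b \o f) u).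
Proof.
elim/table_ind: u => [e|e s v IH] //; rewrite tmap_cat !tcat1 !tcut_cons /= IH.
by case: (b (f s)) => //; rewrite /tcat /tmap.
Qed.

Section DiagramTheory.
Variable X : gset.
Implicit Types (u v w x : atable X) (a b c : anycell X) (m k : nat).

Definition solid m u := all (fun p => m <= adim p.1) u.2.

Lemma solid_cat m u b v :
  solid m (tcat u b v) = [&& solid m u, m <= adim b & solid m v].
Proof. by rewrite /solid /= all_cat /=. Qed.

Lemma solid_le m k u : k <= m -> solid m u -> solid k u.
Proof. by move=> km; apply: sub_all => p; apply: leq_trans. Qed.

Lemma solid_or m u : solid m u \/ exists u0 b v,
  [/\ u = tcat u0 b v, solid m u0 & adim b < m].
Proof.
elim/table_ind: u => [e|e s v IH]; first by left.
case: (ltnP (adim s) m) => sm; first by right; exists (e, [::]), s, v.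
case: IH => [sv|[u0 [b [v' [-> su0 bm]]]]].
  by left; rewrite solid_cat sm.
right; exists (tcat (e, [::]) s u0), b, v'; split=> //.
by rewrite solid_cat sm.
Qed.

Lemma block_ind m (P : atable X -> Prop) :
  (forall u, solid m u -> P u) ->
  (forall u b v, solid m u -> adim b < m -> P v -> P (tcat u b v)) ->
  forall u, P u.
Proof.
move=> P1 PS u; have [n] := ubnP (size u.2); elim: n u => // n IH u le.
case: (solid_or m u) => [/P1//|[u0 [b [v [E su0 bm]]]]].
rewrite E; apply: PS => //; apply: IH; move: le.
by rewrite E /= size_cat /=; lia.
Qed.

Lemma blocks_solid m u : solid m u -> pd_blocks m u = (u, [::]).
Proof.
by move=> su; apply: tcut_solid; apply: sub_all su => p; rewrite -leqNgt.
Qed.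
Lemma blocks_cat m u b v : adim b < m ->
  pd_blocks m (tcat u b v) = tcat (pd_blocks m u) b (pd_blocks m v).
Proof. by move=> bm; exact: (@tcut_cat _ _ (fun b => adim b < m)). Qed.

Lemma pd_src_cat m u b v : adim b < m ->
  pd_src m (tcat u b v) = tcat (pd_src m u) b (pd_src m v).
Proof. by move=> bm; rewrite /pd_src blocks_cat // tmap_cat. Qed.
Lemma pd_tgt_cat m u b v : adim b < m ->
  pd_tgt m (tcat u b v) = tcat (pd_tgt m u) b (pd_tgt m v).
Proof. by move=> bm; rewrite /pd_tgt blocks_cat // tmap_cat. Qed.
Lemma pd_src_solid m u : solid m u -> pd_src m u = (asrc m (tfirst u), [::]).
Proof. by move=> su; rewrite /pd_src blocks_solid. Qed.
Lemma pd_tgt_solid m u : solid m u -> pd_tgt m u = (atgt m (tlast u), [::]).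
Proof. by move=> su; rewrite /pd_tgt blocks_solid. Qed.

Lemma tfirst_src m u : tfirst (pd_src m u) = asrc m (tfirst u).
Proof.
elim/(@block_ind m): u => [u su|u b v su bm IH]; first by rewrite pd_src_solid.
by rewrite pd_src_cat // !tfirst_cat pd_src_solid.
Qed.
Lemma tlast_tgt m u : tlast (pd_tgt m u) = atgt m (tlast u).
Proof.
elim/(@block_ind m): u => [u su|u b v su bm IH]; first by rewrite pd_tgt_solid.
by rewrite pd_tgt_cat // !tlast_cat.
Qed.

Lemma size_src m u : size (pd_src m u).2 = size (pd_blocks m u).2.
Proof. by rewrite size_map. Qed.
Lemma size_tgt m u : size (pd_tgt m u).2 = size (pd_blocks m u).2.
Proof. by rewrite size_map. Qed.

Lemma size_blocks0 m u : size (pd_blocks m u).2 = 0 -> solid m u.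
Proof.
elim/(@block_ind m): u => [//|u b v su bm _].
by rewrite blocks_cat // /= size_cat /= addnS.
Qed.

Lemma solid_src m k u : k <= m -> solid k (pd_src m u) = solid k u.
Proof.
move=> km; elim/(@block_ind m): u => [u su|u b v su bm IH].
  by rewrite pd_src_solid // (solid_le km su).
by rewrite pd_src_cat // !solid_cat IH (solid_le km su) pd_src_solid.
Qed.
Lemma solid_tgt m k u : k <= m -> solid k (pd_tgt m u) = solid k u.
Proof.
move=> km; elim/(@block_ind m): u => [u su|u b v su bm IH].
  by rewrite pd_tgt_solid // (solid_le km su).
by rewrite pd_tgt_cat // !solid_cat IH (solid_le km su) pd_tgt_solid.
Qed.

Lemma src_split m u x b w : pd_src m u = tcat x b w -> adim b < m /\
  exists u0 v, [/\ u = tcat u0 b v, pd_src m u0 = x & pd_src m v = w].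
Proof.
elim/(@block_ind m): u x => [u su|u b' v su bm IH] x.
  by rewrite pd_src_solid //; case: x => a [|p l].
rewrite pd_src_cat // pd_src_solid //; case: x => a [|p l].
  move=> E; have [<- <- <-] := tcat1_inj E; split=> //; exists u, v.
  by rewrite pd_src_solid.
have -> : (a, p :: l) = tcat (a, [::]) p.1 (p.2, l) by case: p.
rewrite tcatA => E; have [<- Ep /IH] := tcat1_inj E.
rewrite -Ep => -[bm' [u0 [v' [Ev Eu Ew]]]]; split=> //.
exists (tcat u b' u0), v'; split=> //; first by rewrite tcatA Ev.
by rewrite pd_src_cat // pd_src_solid // Eu.
Qed.

Lemma tgt_split m u x b w : pd_tgt m u = tcat x b w -> adim b < m /\
  exists u0 v, [/\ u = tcat u0 b v, pd_tgt m u0 = x & pd_tgt m v = w].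
Proof.
elim/(@block_ind m): u x => [u su|u b' v su bm IH] x.
  by rewrite pd_tgt_solid //; case: x => a [|p l].
rewrite pd_tgt_cat // pd_tgt_solid //; case: x => a [|p l].
  move=> E; have [<- <- <-] := tcat1_inj E; split=> //; exists u, v.
  by rewrite pd_tgt_solid.
have -> : (a, p :: l) = tcat (a, [::]) p.1 (p.2, l) by case: p.
rewrite tcatA => E; have [<- Ep /IH] := tcat1_inj E.
rewrite -Ep => -[bm' [u0 [v' [Ev Eu Ew]]]]; split=> //.
exists (tcat u b' u0), v'; split=> //; first by rewrite tcatA Ev.
by rewrite pd_tgt_cat // pd_tgt_solid // Eu.
Qed.

Lemma pd_comp_cat m u b u' v v' : adim b < m ->
  size (pd_blocks m u).2 = size (pd_blocks m v).2 ->
  pd_comp m (tcat u b u') (tcat v b v') = tcat (pd_comp m u v) b (pd_comp m u' v').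
Proof. by move=> bm e; rewrite /pd_comp !blocks_cat // tzip_cat // tflatten_cat. Qed.
Lemma pd_comp_solid m u v : solid m u -> solid m v -> pd_comp m u v = pd_join m u v.
Proof.
move=> su sv; rewrite /pd_comp !blocks_solid // /tzip /tflatten /= cats0.
by case: (pd_join _ _ _).
Qed.
End DiagramTheory.

Section CompTheory.
Variable X : gset.
Implicit Types (u v w x y : atable X) (a b c : anycell X) (m k : nat).

Definition wf u := tlinked (@pd_link X) u.
Definition dims_le n u := all (fun c => adim c <= n) (tops u).

Lemma wf_cat u b v :
  wf (tcat u b v) <-> [/\ wf u, pd_link (tlast u) b (tfirst v) & wf v].
Proof. exact: tlinked_cat. Qed.

Lemma link_le m a b c : pd_link a b c -> m < adim b ->
  asrc m a = asrc m c /\ atgt m a = atgt m c.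
Proof.
case=> _ _ ab cb mb.
rewrite -(asrc_tgt a mb) -(atgt_tgt a (ltnW mb)) ab.
by rewrite -(asrc_src c (ltnW mb)) -(atgt_src c mb) cb.
Qed.

Lemma solid_ends m k u : wf u -> solid k u -> m < k ->
  asrc m (tfirst u) = asrc m (tlast u) /\ atgt m (tfirst u) = atgt m (tlast u).
Proof.
move=> wu su mk; elim/table_ind: u wu su => [//|a b v IH].
case/wf_cat=> _ L wv; rewrite solid_cat => /and3P[_ kb sv].
have [-> ->] := link_le L (leq_trans mk kb).
by rewrite tlast_cat; apply: IH.
Qed.

Lemma solid_dim m u : wf u -> solid m u ->
  u = (tfirst u, [::]) \/ m < adim (tfirst u) /\ m < adim (tlast u).
Proof.
elim/table_ind: u => [a|a b v IH]; first by left.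
case/wf_cat=> _ [ba bc _ _] wv; rewrite solid_cat => /and3P[_ mb sv]; right.
split; first exact: leq_ltn_trans mb ba.
rewrite tlast_cat; case: (IH wv sv) => [E|[]//].
by move: bc; rewrite E; apply: leq_ltn_trans.
Qed.

Lemma solid_dim_le m u : wf u -> solid m u -> adim (tfirst u) <= m ->
  u = (tfirst u, [::]).
Proof. by move=> wu su le; case: (solid_dim wu su) => // -[]; rewrite ltnNge le. Qed.

Lemma link_bd m a b c : adim b < m ->
  pd_link (atgt m a) b (asrc m c) <-> pd_link a b c.
Proof.
move=> bm; rewrite /pd_link adim_tgt adim_src !leq_min bm !andbT.
by rewrite asrc_src ?atgt_tgt // ltnW.
Qed.

Lemma wf_src m u : wf u -> wf (pd_src m u).
Proof.
elim/(@block_ind X m): u => [u su _|u b v su bm IH]; first by rewrite pd_src_solid.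
case/wf_cat=> wu L wv; rewrite pd_src_cat // wf_cat pd_src_solid //.
split=> //; last exact: IH.
case: L => ba bc ab cb; rewrite tfirst_src; split.
- rewrite adim_src leq_min bm andbT.
  by case: (solid_dim wu su) ba => [->//|[le _] _]; apply: ltn_trans le.
- by rewrite adim_src leq_min bc.
- by rewrite atgt_src // (solid_ends wu su bm).2.
- by rewrite asrc_src // ltnW.
Qed.
Lemma wf_tgt m u : wf u -> wf (pd_tgt m u).
Proof.
elim/(@block_ind X m): u => [u su _|u b v su bm IH]; first by rewrite pd_tgt_solid.
case/wf_cat=> wu L wv; rewrite pd_tgt_cat // wf_cat.
split; [by rewrite pd_tgt_solid| |exact: IH].
rewrite tlast_tgt.
have [v0 [E sv wv0 ->]] : exists v0, [/\ tfirst v = tfirst v0,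
  solid m v0, wf v0 & tfirst (pd_tgt m v) = atgt m (tlast v0)].
  case: (solid_or m v) => [sv|[v0 [b' [v' [E sv b'm]]]]].
    by exists v; rewrite pd_tgt_solid.
  exists v0; rewrite E pd_tgt_cat // pd_tgt_solid //; split=> //.
  by move: wv; rewrite E => /wf_cat[].
case: L => ba bc ab cb; rewrite E in bc cb; split.
- by rewrite adim_tgt leq_min ba.
- rewrite adim_tgt leq_min bm andbT.
  by case: (solid_dim wv0 sv) bc => [->//|[_ le] _]; apply: ltn_trans le.
- by rewrite atgt_tgt // ltnW.
- by rewrite asrc_tgt // -(solid_ends wv0 sv bm).1.
Qed.

Lemma pd_src_src m k u : m <= k -> pd_src m (pd_src k u) = pd_src m u.
Proof.
move=> mk; elim/(@block_ind X m): u => [u su|u b v su bm IH].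
  by rewrite pd_src_solid ?solid_src // tfirst_src asrc_src // pd_src_solid.
rewrite (@pd_src_cat X k) ?(leq_trans bm mk) // !(@pd_src_cat X m) // IH.
by congr tcat; rewrite pd_src_solid ?solid_src // tfirst_src asrc_src // pd_src_solid.
Qed.
Lemma pd_tgt_tgt m k u : m <= k -> pd_tgt m (pd_tgt k u) = pd_tgt m u.
Proof.
move=> mk; elim/(@block_ind X m): u => [u su|u b v su bm IH].
  by rewrite pd_tgt_solid ?solid_tgt // tlast_tgt atgt_tgt // pd_tgt_solid.
rewrite (@pd_tgt_cat X k) ?(leq_trans bm mk) // !(@pd_tgt_cat X m) // IH.
by congr tcat; rewrite pd_tgt_solid ?solid_tgt // tlast_tgt atgt_tgt // pd_tgt_solid.
Qed.

Lemma tfirst_tgt m k u : wf u -> m < k ->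
  asrc m (tfirst (pd_tgt k u)) = asrc m (tfirst u).
Proof.
move=> wu mk; case: (solid_or k u) => [su|[u0 [b [v [E su bk]]]]].
  by rewrite pd_tgt_solid // asrc_tgt // (solid_ends wu su mk).1.
move: wu; rewrite E => /wf_cat[wu _ _].
by rewrite pd_tgt_cat // pd_tgt_solid //= asrc_tgt // -(solid_ends wu su mk).1.
Qed.
Lemma tlast_src m k u : wf u -> m < k ->
  atgt m (tlast (pd_src k u)) = atgt m (tlast u).
Proof.
move=> wu mk; elim/(@block_ind X k): u wu => [u su|u b v su bk IH] wu.
  by rewrite pd_src_solid // atgt_src // (solid_ends wu su mk).2.
by rewrite pd_src_cat // !tlast_cat IH //; case/wf_cat: wu.
Qed.

Lemma pd_src_tgt m k u : wf u -> m < k -> pd_src m (pd_tgt k u) = pd_src m u.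
Proof.
move=> wu mk; elim/(@block_ind X m): u wu => [u su|u b v su bm IH] wu.
  by rewrite pd_src_solid ?solid_tgt 1?ltnW // tfirst_tgt // pd_src_solid.
have [wu0 _ wv] := (wf_cat u b v).1 wu.
rewrite (@pd_tgt_cat X k) ?(ltn_trans bm mk) // !(@pd_src_cat X m) // IH //.
congr tcat; rewrite pd_src_solid ?solid_tgt 1?ltnW // tfirst_tgt //.
by rewrite pd_src_solid.
Qed.
Lemma pd_tgt_src m k u : wf u -> m < k -> pd_tgt m (pd_src k u) = pd_tgt m u.
Proof.
move=> wu mk; elim/(@block_ind X m): u wu => [u su|u b v su bm IH] wu.
  by rewrite pd_tgt_solid ?solid_src 1?ltnW // tlast_src // pd_tgt_solid.
have [wu0 _ wv] := (wf_cat u b v).1 wu.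
rewrite (@pd_src_cat X k) ?(ltn_trans bm mk) // !(@pd_tgt_cat X m) // IH //.
congr tcat; rewrite pd_tgt_solid ?solid_src 1?ltnW // tlast_src //.
by rewrite pd_tgt_solid.
Qed.

Lemma dims_cat n u b v : dims_le n (tcat u b v) = dims_le n u && dims_le n v.
Proof. by rewrite /dims_le tops_cat all_cat. Qed.
Lemma dims_src m u : dims_le m (pd_src m u).
Proof.
elim/(@block_ind X m): u => [u su|u b v su bm IH].
  by rewrite pd_src_solid // /dims_le /= adim_src geq_minr.
by rewrite pd_src_cat // dims_cat IH pd_src_solid // /dims_le /= adim_src geq_minr.
Qed.
Lemma dims_tgt m u : dims_le m (pd_tgt m u).
Proof.
elim/(@block_ind X m): u => [u su|u b v su bm IH].
  by rewrite pd_tgt_solid // /dims_le /= adim_tgt geq_minr.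
by rewrite pd_tgt_cat // dims_cat IH pd_tgt_solid // /dims_le /= adim_tgt geq_minr.
Qed.
Lemma dims_leW m n u : m <= n -> dims_le m u -> dims_le n u.
Proof. by move=> mn; apply: sub_all => c le; apply: leq_trans mn. Qed.

Lemma solid_dims m u : wf u -> solid m u -> dims_le m u -> u = (tfirst u, [::]).
Proof. by move=> wu su; rewrite /dims_le /= => /andP[le _]; apply: solid_dim_le su le. Qed.

Lemma pd_src_id m u : wf u -> dims_le m u -> pd_src m u = u.
Proof.
elim/(@block_ind X m): u => [u su wu du|u b v su bm IH /wf_cat[wu _ wv]].
  rewrite pd_src_solid // {2}(solid_dims wu su du) asrc_id //.
  by case/andP: du.
rewrite dims_cat pd_src_cat // => /andP[du dv]; rewrite IH // pd_src_solid //.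
rewrite {2}(solid_dims wu su du) asrc_id //; by case/andP: du.
Qed.
Lemma pd_tgt_id m u : wf u -> dims_le m u -> pd_tgt m u = u.
Proof.
elim/(@block_ind X m): u => [u su wu du|u b v su bm IH /wf_cat[wu _ wv]].
  rewrite pd_tgt_solid // (solid_dims wu su du) /= atgt_id //.
  by case/andP: du.
rewrite dims_cat pd_tgt_cat // => /andP[du dv]; rewrite IH // pd_tgt_solid //.
rewrite (solid_dims wu su du) /= atgt_id //; by case/andP: du.
Qed.

Lemma pd_bd1 m a : adim a <= m ->
  pd_src m (a, [::]) = (a, [::]) /\ pd_tgt m (a, [::]) = (a, [::]).
Proof. by move=> le; rewrite pd_src_solid // pd_tgt_solid //= asrc_id ?atgt_id. Qed.

Definition cpb m u v := [/\ wf u, wf v & pd_tgt m u = pd_src m v].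

Lemma cpb_size m u v : cpb m u v -> size (pd_blocks m u).2 = size (pd_blocks m v).2.
Proof. by case=> _ _ E; rewrite -size_tgt E size_src. Qed.

Lemma cpb_solid k m u v : k <= m -> cpb m u v -> solid k u = solid k v.
Proof. by move=> km [_ _ E]; rewrite -(solid_tgt _ km) E solid_src. Qed.

Lemma cpb_ends m u v : cpb m u v -> solid m u -> atgt m (tlast u) = asrc m (tfirst v).
Proof.
move=> H su; have sv : solid m v by rewrite -(cpb_solid (leqnn m) H).
by case: H => _ _; rewrite pd_tgt_solid // pd_src_solid // => -[].
Qed.

Lemma cpb_splitl m u b u' w : adim b < m -> cpb m (tcat u b u') w ->
  exists v v', [/\ w = tcat v b v', cpb m u v & cpb m u' v'].
Proof.
move=> bm [/wf_cat[wu _ wu'] ww]; rewrite pd_tgt_cat // => /esym/src_split[_].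
case=> v [v' [E E1 E2]]; exists v, v'; move: ww; rewrite E => /wf_cat[wv _ wv'].
by split.
Qed.

Lemma cpb_splitr m u v b v' : adim b < m -> cpb m u (tcat v b v') ->
  exists w w', [/\ u = tcat w b w', cpb m w v & cpb m w' v'].
Proof.
move=> bm [wu /wf_cat[wv _ wv']]; rewrite pd_src_cat // => /tgt_split[_].
case=> w [w' [E E1 E2]]; exists w, w'; move: wu; rewrite E => /wf_cat[ww _ ww'].
by split.
Qed.

Lemma comp_ind k m (P : atable X -> atable X -> Prop) : k <= m ->
  (forall u v, solid k u -> solid k v -> cpb m u v -> P u v) ->
  (forall u b u' v v', solid k u -> solid k v -> adim b < k ->
     cpb m u v -> cpb m u' v' ->
     pd_link (tlast u) b (tfirst u') -> pd_link (tlast v) b (tfirst v') ->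
     P u v -> P u' v' -> P (tcat u b u') (tcat v b v')) ->
  forall u v, cpb m u v -> P u v.
Proof.
move=> km P1 PS u; elim/(@block_ind X k): u => [u su|u b u' su bk IH] w H.
  by apply: P1; rewrite // -(cpb_solid km H).
have [v [v' [E H1 H2]]] := cpb_splitl (leq_trans bk km) H.
have sv : solid k v by rewrite -(cpb_solid km H1).
case: H => /wf_cat[_ L1 _]; rewrite E => /wf_cat[_ L2 _] _.
by apply: PS => //; [apply: P1 | apply: IH].
Qed.

Lemma joinP m u v : cpb m u v -> solid m u ->
  [\/ u = (asrc m (tfirst v), [::]) /\ pd_comp m u v = v,
      v = (atgt m (tlast u), [::]) /\ pd_comp m u v = u |
      [/\ m < adim (tfirst u), m < adim (tfirst v), m < adim (tlast u),
          m < adim (tlast v) & pd_comp m u v = tcat u (atgt m (tlast u)) v]].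
Proof.
move=> H su; have sv : solid m v by rewrite -(cpb_solid (leqnn m) H).
have E := cpb_ends H su; case: H => wu wv _.
rewrite pd_comp_solid // /pd_join; case: leqP => [le|lt].
  constructor 1; split=> //; rewrite -E; have := solid_dim_le wu su le.
  by case: (u) le => a l /= le ->; rewrite atgt_id.
case: leqP => [le'|lt'].
  constructor 2; split=> //; rewrite E; have := solid_dim_le wv sv le'.
  by case: (v) le' => a l /= le' ->; rewrite asrc_id.
constructor 3; split=> //.
  by case: (solid_dim wu su) lt => [->|[]].
by case: (solid_dim wv sv) lt' => [->|[]].
Qed.

Lemma comp_bd m u v : cpb m u v ->
  [/\ wf (pd_comp m u v), pd_src m (pd_comp m u v) = pd_src m u &
      pd_tgt m (pd_comp m u v) = pd_tgt m v].
Proof.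
move: u v; apply: (@comp_ind m m) => // [u v su sv H|u b u' v v' su sv bm H H' L L' I I'].
  have [wu wv E] := H.
  case: (joinP H su) => [[Eu ->]|[Ev ->]|[d1 d2 d3 d4 ->]].
  - by split=> //; rewrite -E Eu (pd_bd1 _).1 ?(pd_bd1 _).2 // adim_src geq_minr.
  - by split=> //; rewrite E Ev (pd_bd1 _).1 ?(pd_bd1 _).2 // adim_tgt geq_minr.
  have sw : solid m (tcat u (atgt m (tlast u)) v).
    by rewrite solid_cat su sv adim_tgt leq_min leqnn andbT ltnW.
  split.
  - apply/wf_cat; split=> //.
    have dm : adim (atgt m (tlast u)) = m by rewrite adim_tgt; apply/minn_idPr/ltnW.
    by rewrite /pd_link dm; split=> //; rewrite -(cpb_ends H su).
  - by rewrite pd_src_solid // pd_src_solid.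
  - by rewrite pd_tgt_solid // tlast_cat pd_tgt_solid.
case: I I' => w1 s1 t1 [w2 s2 t2].
rewrite pd_comp_cat ?(cpb_size H) //; split.
- apply/wf_cat; split=> //; apply/(link_bd _ _ bm).
  rewrite -tlast_tgt -tfirst_src t1 s2 tlast_tgt tfirst_src; apply/(link_bd _ _ bm).
  case: L L' => a1 a2 a3 a4 [c1 c2 c3 c4].
  by split.
- by rewrite !pd_src_cat // s1 s2.
- by rewrite !pd_tgt_cat // t1 t2.
Qed.
End CompTheory.

Section CompLaws.
Variable X : gset.
Implicit Types (u v w x y : atable X) (a b c : anycell X) (m k : nat).

Lemma cpb_lo k m u v : k < m -> cpb m u v ->
  pd_src k u = pd_src k v /\ pd_tgt k u = pd_tgt k v.
Proof.
move=> km [wu wv E].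
rewrite -(pd_src_tgt wu km) -(pd_tgt_tgt u (ltnW km)) E.
by rewrite pd_src_src ?pd_tgt_src // ltnW.
Qed.

Lemma cpb_src k m u v : m < k -> cpb m u v -> cpb m (pd_src k u) (pd_src k v).
Proof.
move=> mk [wu wv E]; split; [exact: wf_src|exact: wf_src|].
by rewrite pd_tgt_src // pd_src_src // ltnW.
Qed.
Lemma cpb_tgt k m u v : m < k -> cpb m u v -> cpb m (pd_tgt k u) (pd_tgt k v).
Proof.
move=> mk [wu wv E]; split; [exact: wf_tgt|exact: wf_tgt|].
by rewrite pd_src_tgt // pd_tgt_tgt // ltnW.
Qed.

Lemma pd_tgt_src_id m u : wf u -> pd_tgt m (pd_src m u) = pd_src m u.
Proof. by move=> wu; apply: pd_tgt_id; [apply: wf_src|apply: dims_src]. Qed.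
Lemma pd_src_tgt_id m u : wf u -> pd_src m (pd_tgt m u) = pd_tgt m u.
Proof. by move=> wu; apply: pd_src_id; [apply: wf_tgt|apply: dims_tgt]. Qed.

Lemma cpb_unitl m u : wf u -> cpb m (pd_src m u) u.
Proof. by move=> wu; split=> //; [apply: wf_src|apply: pd_tgt_src_id]. Qed.
Lemma cpb_unitr m u : wf u -> cpb m u (pd_tgt m u).
Proof. by move=> wu; split=> //; [apply: wf_tgt|rewrite pd_src_tgt_id]. Qed.

Lemma comp_unitl m u : wf u -> pd_comp m (pd_src m u) u = u.
Proof.
elim/(@block_ind X m): u => [u su wu|u b v su bm IH /wf_cat[wu _ wv]].
  rewrite pd_comp_solid ?solid_src // pd_src_solid // /pd_join /=.
  by rewrite adim_src geq_minr.
rewrite pd_src_cat // pd_comp_cat ?IH ?size_src //; last first.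
  by rewrite (cpb_size (cpb_unitl m wu)).
congr tcat; rewrite pd_comp_solid ?solid_src // pd_src_solid // /pd_join /=.
by rewrite adim_src geq_minr.
Qed.
Lemma comp_unitr m u : wf u -> pd_comp m u (pd_tgt m u) = u.
Proof.
have base v : wf v -> solid m v -> pd_comp m v (pd_tgt m v) = v.
  move=> wv sv; rewrite pd_comp_solid ?solid_tgt // pd_tgt_solid // /pd_join /=.
  case: leqP => [le|_]; last by rewrite adim_tgt geq_minr.
  have := solid_dim_le wv sv le.
  by case: (v) le => a l /= le ->; rewrite atgt_id.
elim/(@block_ind X m): u => [u su wu|u b v su bm IH /wf_cat[wu _ wv]].
  exact: base.
rewrite pd_tgt_cat // pd_comp_cat ?IH ?base //.
by rewrite (cpb_size (cpb_unitr m wu)).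
Qed.

Lemma comp_high m u v : solid m u -> solid m v -> m < adim (tfirst u) ->
  m < adim (tfirst v) -> pd_comp m u v = tcat u (atgt m (tlast u)) v.
Proof.
move=> su sv du dv; rewrite pd_comp_solid // /pd_join.
by rewrite (leqNgt _ m) du (leqNgt _ m) dv.
Qed.

Lemma solid_high m u : wf u -> solid m u ->
  (m < adim (tfirst u)) = (m < adim (tlast u)).
Proof. by move=> wu su; case: (solid_dim wu su) => [->|[-> ->]]. Qed.

Lemma comp_unitl' m u v : cpb m u v -> dims_le m u -> pd_comp m u v = v.
Proof.
case=> wu wv E du; have -> : u = pd_src m v by rewrite -E pd_tgt_id.
exact: comp_unitl.
Qed.
Lemma comp_unitr' m u v : cpb m u v -> dims_le m v -> pd_comp m u v = u.
Proof.
case=> wu wv E du; have -> : v = pd_tgt m u by rewrite E pd_src_id.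
exact: comp_unitr.
Qed.

Lemma solid_low m u : wf u -> solid m u -> dims_le m u \/ m < adim (tfirst u).
Proof.
move=> wu su; case: leqP => [le|]; [left|by right].
by rewrite (solid_dim_le wu su le) /dims_le /= le.
Qed.

Lemma src_comp k m u v : m < k -> cpb m u v ->
  pd_src k (pd_comp m u v) = pd_comp m (pd_src k u) (pd_src k v).
Proof.
move=> mk; move: u v; apply: (@comp_ind _ m m) => // [u v su sv H|].
  have [wu wv E] := H.
  have ssu : solid m (pd_src k u) by rewrite solid_src // ltnW.
  have ssv : solid m (pd_src k v) by rewrite solid_src // ltnW.
  have K := cpb_src mk H.
  case: (solid_low wu su) => [du|d1].
    rewrite (comp_unitl' H du) (comp_unitl' K) //.
    by rewrite pd_src_id //; apply: dims_leW du; apply: ltnW.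
  case: (solid_low wv sv) => [dv|d2].
    rewrite (comp_unitr' H dv) (comp_unitr' K) //.
    by rewrite pd_src_id //; apply: dims_leW dv; apply: ltnW.
  rewrite (comp_high su sv) // (comp_high ssu ssv); last 2 first.
  - by rewrite tfirst_src adim_src leq_min d1.
  - by rewrite tfirst_src adim_src leq_min d2.
  by rewrite tlast_src // pd_src_cat // adim_tgt gtn_min mk orbT.
move=> u b u' v v' su sv bm H H' L L' I I'.
have bk := ltn_trans bm mk.
rewrite (pd_comp_cat _ _ bm (cpb_size H)) !pd_src_cat //.
by rewrite (pd_comp_cat _ _ bm (cpb_size (cpb_src mk H))) I I'.
Qed.
Lemma tgt_comp k m u v : m < k -> cpb m u v ->
  pd_tgt k (pd_comp m u v) = pd_comp m (pd_tgt k u) (pd_tgt k v).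
Proof.
move=> mk; move: u v; apply: (@comp_ind _ m m) => // [u v su sv H|].
  have [wu wv E] := H.
  have ssu : solid m (pd_tgt k u) by rewrite solid_tgt // ltnW.
  have ssv : solid m (pd_tgt k v) by rewrite solid_tgt // ltnW.
  have K := cpb_tgt mk H.
  case: (solid_low wu su) => [du|d1].
    rewrite (comp_unitl' H du) (comp_unitl' K) //.
    by rewrite pd_tgt_id //; apply: dims_leW du; apply: ltnW.
  case: (solid_low wv sv) => [dv|d2].
    rewrite (comp_unitr' H dv) (comp_unitr' K) //.
    by rewrite pd_tgt_id //; apply: dims_leW dv; apply: ltnW.
  rewrite (comp_high su sv) // (comp_high ssu ssv); last 2 first.
  - by rewrite solid_high ?tlast_tgt ?adim_tgt ?leq_min -?solid_high ?d1 //; apply: wf_tgt.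
  - by rewrite solid_high ?tlast_tgt ?adim_tgt ?leq_min -?solid_high ?d2 //; apply: wf_tgt.
  rewrite tlast_tgt atgt_tgt; last exact: ltnW.
  by rewrite pd_tgt_cat // adim_tgt gtn_min mk orbT.
move=> u b u' v v' su sv bm H H' L L' I I'.
have bk := ltn_trans bm mk.
rewrite (pd_comp_cat _ _ bm (cpb_size H)) !pd_tgt_cat //.
by rewrite (pd_comp_cat _ _ bm (cpb_size (cpb_tgt mk H))) I I'.
Qed.
Lemma cpb_compl m u v w : cpb m u v -> cpb m v w -> cpb m (pd_comp m u v) w.
Proof. by move=> /comp_bd[c1 c2 c3] [wv ww E]; split; rewrite ?c3. Qed.
Lemma cpb_compr m u v w : cpb m u v -> cpb m v w -> cpb m u (pd_comp m v w).
Proof. by move=> [wu wv E] /comp_bd[c1 c2 c3]; split; rewrite ?c2. Qed.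

Lemma compA_solid m u v w : solid m u -> cpb m u v -> cpb m v w ->
  pd_comp m (pd_comp m u v) w = pd_comp m u (pd_comp m v w).
Proof.
move=> su H K; have [wu wv _] := H; have [_ ww _] := K.
have sv : solid m v by rewrite -(cpb_solid (leqnn m) H).
have sw : solid m w by rewrite -(cpb_solid (leqnn m) K).
case: (solid_low wu su) => [du|du].
  by rewrite (comp_unitl' H) // (comp_unitl' (cpb_compr H K)).
case: (solid_low ww sw) => [dw|dw].
  by rewrite (comp_unitr' K) // (comp_unitr' (cpb_compl H K)).
case: (solid_low wv sv) => [dv|dv].
  by rewrite (comp_unitr' H) // (comp_unitl' K).
have e : adim (atgt m (tlast u)) = m.
  by rewrite adim_tgt; apply/minn_idPr; rewrite ltnW // -solid_high.
have e' : adim (atgt m (tlast v)) = m.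
  by rewrite adim_tgt; apply/minn_idPr; rewrite ltnW // -solid_high.
rewrite (comp_high su sv) // (comp_high sv sw) //.
rewrite [LHS]comp_high ?solid_cat ?su ?sv ?e ?leqnn //.
rewrite [RHS]comp_high ?solid_cat ?sw ?sv ?e' ?leqnn //.
by rewrite tlast_cat tcatA.
Qed.

Lemma compA m u v w : cpb m u v -> cpb m v w ->
  pd_comp m (pd_comp m u v) w = pd_comp m u (pd_comp m v w).
Proof.
elim/(@block_ind X m): u v w => [u su v w|u b u' su bm IH v0 w0 H K].
  exact: compA_solid.
have [v [v' [E H1 H2]]] := cpb_splitl bm H.
move: K; rewrite E => K; have [w [w' [E' K1 K2]]] := cpb_splitl bm K.
rewrite E' (pd_comp_cat _ _ bm (cpb_size H1)) (pd_comp_cat _ _ bm (cpb_size K1)).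
rewrite (pd_comp_cat _ _ bm (cpb_size (cpb_compl H1 K1))).
rewrite (pd_comp_cat _ _ bm (cpb_size (cpb_compr H1 K1))).
by rewrite IH // compA_solid.
Qed.

Lemma tcat_injr u b v v' : tcat u b v = tcat u b v' -> v = v'.
Proof.
case: v v' => a l [a' l'] [] E; have := congr1 (drop (size u.2)) E.
by rewrite !drop_size_cat // => -[-> ->].
Qed.

Lemma split_uniq k u b v u' b' v' : adim b < k -> adim b' < k ->
  solid k u -> solid k u' -> tcat u b v = tcat u' b' v' -> [/\ u = u', b = b' & v = v'].
Proof.
move=> bk bk' su su' E; have := congr1 (pd_blocks k) E.
rewrite !blocks_cat // (blocks_solid su) (blocks_solid su') => e; have [e1 e2 _] := tcat1_inj e.
by move: E; rewrite e1 e2 => /tcat_injr.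
Qed.

Lemma dims_first k u : dims_le k u -> adim (tfirst u) <= k.
Proof. by case/andP. Qed.

Lemma src_low m k u : wf u -> k < m -> solid k u -> dims_le k (pd_src m u) ->
  dims_le k u.
Proof.
move=> wu km su /dims_first; rewrite tfirst_src adim_src.
rewrite geq_min (leqNgt m) km orbF => le; case: (solid_low wu su) => //.
by rewrite ltnNge le.
Qed.
Lemma tgt_low m k u : wf u -> k < m -> solid k u -> dims_le k (pd_tgt m u) ->
  dims_le k u.
Proof.
move=> wu km su d; have st : solid k (pd_tgt m u) by rewrite solid_tgt // ltnW.
case: (solid_low wu su) => //; rewrite solid_high // => lt.
have := dims_first d; rewrite leqNgt solid_high ?tlast_tgt ?adim_tgt ?leq_min ?lt ?km //.
exact: wf_tgt.
Qed.

Lemma cpb_comp2 k m u v w x : k < m -> cpb k u v -> cpb k w x ->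
  cpb m u w -> cpb m v x -> cpb m (pd_comp k u v) (pd_comp k w x).
Proof.
move=> km H1 H2 K1 K2; split; [by case: (comp_bd H1)|by case: (comp_bd H2)|].
by rewrite tgt_comp // src_comp //; case: K1 => _ _ ->; case: K2 => _ _ ->.
Qed.
Lemma cpb_comp3 k m u v w x : k < m -> cpb k u v -> cpb k w x ->
  cpb m u w -> cpb m v x -> cpb k (pd_comp m u w) (pd_comp m v x).
Proof.
move=> km H1 H2 K1 K2; have [c1 c2 c3] := comp_bd K1; have [d1 d2 d3] := comp_bd K2.
split=> //; rewrite -(pd_tgt_tgt _ (ltnW km)) c3 pd_tgt_tgt 1?ltnW //.
rewrite -(pd_src_src _ (ltnW km)) d2 pd_src_src 1?ltnW // (cpb_lo km K2).1.
by case: H2.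
Qed.

Lemma comp_first k m u v : k < m -> cpb m u v ->
  k < adim (tfirst u) -> k < adim (tfirst (pd_comp m u v)).
Proof.
move=> km /comp_bd[_ E _] lt; have := congr1 (fun w => adim (tfirst w)) E.
rewrite !tfirst_src !adim_src => e.
have : k < minn (adim (tfirst u)) m by rewrite leq_min lt.
by rewrite -e leq_min => /andP[].
Qed.
Lemma comp_last k m u v : k < m -> cpb m u v ->
  atgt k (tlast (pd_comp m u v)) = atgt k (tlast v).
Proof.
move=> km /comp_bd[_ _ E].
by rewrite -(atgt_tgt _ (ltnW km)) -tlast_tgt E tlast_tgt atgt_tgt // ltnW.
Qed.
Lemma comp_solid k m u v : k <= m -> cpb m u v -> solid k (pd_comp m u v) = solid k u.
Proof. by move=> km /comp_bd[_ E _]; rewrite -(solid_src _ km) E solid_src. Qed.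

Lemma interchange_solid k m u v w x : k < m -> solid k u -> cpb k u v -> cpb k w x ->
  cpb m u w -> cpb m v x ->
  pd_comp m (pd_comp k u v) (pd_comp k w x) = pd_comp k (pd_comp m u w) (pd_comp m v x).
Proof.
move=> km su H1 H2 K1 K2; have K3 := cpb_comp3 km H1 H2 K1 K2.
have [wu wv E1] := H1; have [ww wx E2] := H2; have [_ _ F1] := K1.
have [_ _ F2] := K2.
have sv : solid k v by rewrite -(cpb_solid (leqnn k) H1).
have sw : solid k w by rewrite -(cpb_solid (ltnW km) K1).
have sx : solid k x by rewrite -(cpb_solid (ltnW km) K2).
have low y z : cpb m y z -> solid k y -> solid k z -> dims_le k y -> y = z /\ dims_le k z.
  move=> [wy wz E] sy sz dy.
  have dy' := dims_leW (ltnW km) dy.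
  have dz : dims_le k z by apply: (@src_low m) => //; rewrite -E pd_tgt_id.
  have dz' := dims_leW (ltnW km) dz.
  by split=> //; rewrite -(pd_tgt_id wy dy') E pd_src_id.
have low' y z : cpb m y z -> solid k y -> solid k z -> dims_le k z -> dims_le k y.
  move=> [wy wz E] sy sz dz.
  by apply: (@tgt_low m) => //; rewrite E pd_src_id //; apply: dims_leW dz; apply: ltnW.
case: (solid_low wu su) => [du|hu].
  have [e dw] := low _ _ K1 su sw du.
  rewrite (comp_unitl' H1) // (comp_unitl' H2) // (comp_unitl' K3) //.
  by rewrite -e comp_unitl' //; [split=> //; rewrite {2}e|apply: dims_leW du; apply: ltnW].
case: (solid_low wv sv) => [dv|hv].
  have [e dx] := low _ _ K2 sv sx dv.
  rewrite (comp_unitr' H1) // (comp_unitr' H2) // (comp_unitr' K3) //.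
  by rewrite -e comp_unitl' //; [split=> //; rewrite {2}e|apply: dims_leW dv; apply: ltnW].
case: (solid_low ww sw) => [dw|hw].
  by have := low' _ _ K1 su sw dw; move/dims_first; rewrite leqNgt hu.
case: (solid_low wx sx) => [dx|hx].
  by have := low' _ _ K2 sv sx dx; move/dims_first; rewrite leqNgt hv.
rewrite (comp_high su sv) // (comp_high sw sx) //.
have -> : atgt k (tlast u) = atgt k (tlast w).
  by have := (cpb_lo km K1).2; rewrite !pd_tgt_solid // => -[].
have dk : adim (atgt k (tlast w)) = k.
  by rewrite adim_tgt; apply/minn_idPr; rewrite ltnW // -solid_high.
rewrite pd_comp_cat ?dk ?(cpb_size K1) // [RHS]comp_high ?comp_first ?comp_solid // 1?ltnW //.
by rewrite (comp_last km K1).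
Qed.

Lemma interchange k m u v w x : k < m -> cpb k u v -> cpb k w x ->
  cpb m u w -> cpb m v x ->
  pd_comp m (pd_comp k u v) (pd_comp k w x) = pd_comp k (pd_comp m u w) (pd_comp m v x).
Proof.
move=> km; elim/(@block_ind X k): u v w x => [u su v w x|u b u' su bk IH v0 w0 x0].
  exact: interchange_solid.
move=> H1 H2 K1 K2.
have [v [v' [E H11 H12]]] := cpb_splitl bk H1; rewrite {v0}E in H1 K2 *.
have [w [w' [E K11 K12]]] := cpb_splitl (ltn_trans bk km) K1; rewrite {w0}E in H2 K1 *.
have [x [x' [E H21 H22]]] := cpb_splitl bk H2; rewrite {x0}E in H2 K2 *.
have [y [y' [E K21 K22]]] := cpb_splitl (ltn_trans bk km) K2.
have sv : solid k v by rewrite -(cpb_solid (leqnn k) H11).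
have sw : solid k w by rewrite -(cpb_solid (ltnW km) K11).
have sx : solid k x by rewrite -(cpb_solid (leqnn k) H21).
have sy : solid k y by rewrite -(cpb_solid (ltnW km) K21).
have [e1 _ e2] := split_uniq bk bk sx sy E; rewrite -{}e1 -{}e2 in K21 K22.
have bm := ltn_trans bk km.
rewrite (pd_comp_cat _ _ bk (cpb_size H11)) (pd_comp_cat _ _ bk (cpb_size H21)).
rewrite (pd_comp_cat _ _ bm (cpb_size K11)) (pd_comp_cat _ _ bm (cpb_size K21)).
rewrite (pd_comp_cat _ _ bm (cpb_size (cpb_comp2 km H11 H21 K11 K21))).
rewrite (pd_comp_cat _ _ bk (cpb_size (cpb_comp3 km H11 H21 K11 K21))).
by rewrite IH // interchange_solid.
Qed.
End CompLaws.

Section GlueTheory.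
Variables (X Y : gset) (v : anycell Y -> atable X).
Hypothesis v_wf : forall c, wf (v c).
Hypothesis v_src : forall m c, v (asrc m c) = pd_src m (v c).
Hypothesis v_tgt : forall m c, v (atgt m c) = pd_tgt m (v c).
Implicit Types (U V W : atable Y) (d i m k : nat).

(* The gluing of a table in Y whose entries are interpreted as diagrams in X. *)
Definition gl d i U := pd_glue d i (tmap (@adim Y) v U).

Lemma gl1 d i c : gl d i (c, [::]) = v c.
Proof. by elim: d i => [//|d IH] i; rewrite -(IH i.+1). Qed.

Lemma gl_solid d i U : solid i.+1 U -> gl d.+1 i U = gl d i.+1 U.
Proof.
move=> sU; rewrite /gl /= tcut_map.
by rewrite -[tcut _ U]/(pd_blocks i.+1 U) blocks_solid.
Qed.

Lemma gl_cat d i U b W : solid i.+1 U -> adim b < i.+1 ->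
  gl d.+1 i (tcat U b W) = pd_comp i (gl d i.+1 U) (gl d.+1 i W).
Proof.
move=> sU bi; rewrite /gl /= !tcut_map.
rewrite -[tcut _ (tcat U b W)]/(pd_blocks i.+1 (tcat U b W)).
by rewrite -[tcut _ W]/(pd_blocks i.+1 W) blocks_cat // blocks_solid.
Qed.

Definition good d i U := [/\ wf U, solid i U & dims_le (i + d) U].

Lemma good0 i U : good 0 i U -> U = (tfirst U, [::]).
Proof. by case=> wU sU; rewrite addn0; apply: solid_dims. Qed.

Lemma good_cat d i U b W : good d i (tcat U b W) -> adim b < i.+1 -> solid i.+1 U ->
  [/\ good d i U, adim b = i, pd_link (tlast U) b (tfirst W) & good d i W].
Proof.
case=> /wf_cat[wU L wW]; rewrite solid_cat dims_cat => /and3P[sU ib sW] /andP[dU dW].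
by rewrite ltnS => bi sU'; split=> //; apply/eqP; rewrite eqn_leq bi.
Qed.
Lemma goodS d i U : good d.+1 i U -> solid i.+1 U -> good d i.+1 U.
Proof. by case=> wU _; rewrite addnS => dU sU; split. Qed.

Lemma good_src d i m U : i <= m -> good d i U -> good d i (pd_src m U).
Proof.
move=> im; elim/(@block_ind Y m): U => [U sU|U b W sU bm IH] [wU sU' dU].
  split; [exact: wf_src|by rewrite solid_src|].
  rewrite pd_src_solid // /dims_le /= andbT adim_src.
  by apply: leq_trans (geq_minl _ _) _; apply: dims_first.
split; [exact: wf_src|by rewrite solid_src|].
have [wU0 _ wW] := (wf_cat _ _ _).1 wU.
move: sU' dU; rewrite solid_cat dims_cat => /and3P[sU0 _ sW] /andP[dU dW].
rewrite pd_src_cat // dims_cat; apply/andP; split; last first.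
  by have [] := IH (And3 wW sW dW).
rewrite pd_src_solid // /dims_le /= andbT adim_src.
by apply: leq_trans (geq_minl _ _) _; apply: dims_first.
Qed.

Lemma gl_main d i U : good d i U ->
  [/\ wf (gl d i U),
    forall m, i <= m -> pd_src m (gl d i U) = gl d i (pd_src m U) &
    forall m, i <= m -> pd_tgt m (gl d i U) = gl d i (pd_tgt m U)].
Proof.
elim: d i U => [|d IHd] i U G.
  by rewrite (good0 G) gl1; split=> // m _; rewrite -?v_src -?v_tgt.
have base V : solid i.+1 V -> good d.+1 i V -> [/\ wf (gl d.+1 i V),
    forall m, i <= m -> pd_src m (gl d.+1 i V) = gl d.+1 i (pd_src m V) &
    forall m, i <= m -> pd_tgt m (gl d.+1 i V) = gl d.+1 i (pd_tgt m V)].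
  move=> sV GV; rewrite gl_solid //; have [w s t] := IHd _ _ (goodS GV sV).
  have [wV siV _] := GV.
  split=> // m; rewrite leq_eqVlt => /predU1P[<-|im].
  - rewrite -(pd_src_src _ (leqnSn i)) s // (pd_src_solid sV) gl1.
    by rewrite -v_src asrc_src // pd_src_solid // gl1.
  - by rewrite s // gl_solid // solid_src.
  - rewrite -(pd_tgt_tgt _ (leqnSn i)) t // (pd_tgt_solid sV) gl1.
    by rewrite -v_tgt atgt_tgt // pd_tgt_solid // gl1.
  - by rewrite t // gl_solid // solid_tgt.
elim/(@block_ind Y i.+1): U G => [V|U b W sU bi IH G]; first exact: base.
have [GU bE L GW] := good_cat G bi sU.
have [wu su tu] := base _ sU GU; have [ww sw tw] := IH GW.
have [_ siU _] := GU; have [_ siW _] := GW; have [_ siC _] := G.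
have H : cpb i (gl d i.+1 U) (gl d.+1 i W).
  rewrite -gl_solid //; split=> //; rewrite tu // sw //.
  rewrite pd_tgt_solid // pd_src_solid // !gl1.
  by case: L; rewrite bE => _ _ -> ->.
rewrite gl_cat //; have [c1 c2 c3] := comp_bd H; split=> // m.
  rewrite leq_eqVlt => /predU1P[<-|im].
    by rewrite c2 -gl_solid // su // !pd_src_solid.
  rewrite src_comp // pd_src_cat ?bE // gl_cat ?solid_src ?bE //.
  by rewrite -!gl_solid ?solid_src // su ?sw // ltnW.
rewrite leq_eqVlt => /predU1P[<-|im].
  by rewrite c3 tw // !pd_tgt_solid // tlast_cat.
rewrite tgt_comp // pd_tgt_cat ?bE // gl_cat ?solid_tgt ?bE //.
by rewrite -!gl_solid ?solid_tgt // tu ?tw // ltnW.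
Qed.

Lemma gl_wf d i U : good d i U -> wf (gl d i U).
Proof. by case/gl_main. Qed.
Lemma gl_src d i U m : good d i U -> i <= m -> pd_src m (gl d i U) = gl d i (pd_src m U).
Proof. by case/gl_main=> _ E _; apply: E. Qed.
Lemma gl_tgt d i U m : good d i U -> i <= m -> pd_tgt m (gl d i U) = gl d i (pd_tgt m U).
Proof. by case/gl_main=> _ _; apply. Qed.

Lemma gl_dims d i U m : good d i U -> i <= m -> dims_le m U -> dims_le m (gl d i U).
Proof.
move=> G im dU; have [wU _ _] := G.
by rewrite -(pd_src_id wU dU) -gl_src //; apply: dims_src.
Qed.

Lemma gl_cpb d i U V m : good d i U -> good d i V -> i <= m -> cpb m U V ->
  cpb m (gl d i U) (gl d i V).
Proof.
move=> GU GV im [_ _ E]; split; [exact: gl_wf|exact: gl_wf|].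
by rewrite gl_tgt // gl_src // E.
Qed.

Lemma gl_cat_cpb d i U b W : good d.+1 i (tcat U b W) -> solid i U -> adim b < i.+1 ->
  cpb i (gl d.+1 i U) (gl d.+1 i W).
Proof.
case=> /wf_cat[wU L wW]; rewrite solid_cat dims_cat.
move=> /and3P[sU ib sW] /andP[dU dW] _ bi.
have bE : adim b = i by apply/eqP; rewrite eqn_leq ib -ltnS bi.
have [GU GW] : good d.+1 i U /\ good d.+1 i W by [].
split; [exact: gl_wf|exact: gl_wf|].
rewrite gl_tgt // gl_src // pd_tgt_solid // pd_src_solid // !gl1.
by case: L; rewrite bE => _ _ -> ->.
Qed.

Lemma gl_lift1 d i U : good d i U -> gl d i U = gl d.+1 i U.
Proof.
elim: d i U => [|d IHd] i U G; first by rewrite (good0 G) !gl1.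
elim/(@block_ind Y i.+1): U G => [V sV G|U b W sU bi IH G].
  by rewrite !(gl_solid _ sV) IHd //; apply: goodS.
have [GU bE L GW] := good_cat G bi sU.
by rewrite !(gl_cat _ _ sU bi) IH // IHd //; apply: goodS.
Qed.

Lemma gl_lift d d' i U : d <= d' -> good d i U -> gl d i U = gl d' i U.
Proof.
move=> dd [wU sU dU]; rewrite -(subnKC dd); elim: (d' - d) => [|e IH].
  by rewrite addn0.
rewrite addnS -gl_lift1 //; split=> //; apply: dims_leW dU.
by rewrite addnA leq_addr.
Qed.

Lemma gl_cat_gen d i U b W : good d.+1 i (tcat U b W) ->
  adim b < i.+1 -> gl d.+1 i (tcat U b W) = pd_comp i (gl d.+1 i U) (gl d.+1 i W).
Proof.
elim/(@block_ind Y i.+1): U => [V sV G bi|U c V sU ci IH G bi].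
  by rewrite gl_cat // -gl_solid.
rewrite tcatA in G *.
have [GU cE L GVW] := good_cat G ci sU.
have [wVW sVW dVW] := GVW; have [wG sG dG] := G.
move: (sVW); rewrite solid_cat => /and3P[siV ib siW].
rewrite (gl_cat _ _ sU ci) (IH GVW bi) (gl_cat _ _ sU ci) -!(gl_solid _ sU).
have siU : solid i U by case: GU.
have K := gl_cat_cpb GVW siV bi.
have H : cpb i (gl d.+1 i U) (gl d.+1 i V).
  apply: (@gl_cat_cpb _ _ _ c) => //; split.
  - by move: wG; rewrite -tcatA => /wf_cat[].
  - by rewrite solid_cat siU cE leqnn.
  - by move: dG; rewrite -tcatA dims_cat => /andP[].
by rewrite compA.
Qed.

Lemma gl_comp d i U V m : i <= m -> good d i U -> good d i V -> cpb m U V ->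
  gl d i (pd_comp m U V) = pd_comp m (gl d i U) (gl d i V).
Proof.
elim: d i m U V => [|d IHd] i m U V im GU GV H.
  have dU : dims_le m U.
    by case: GU => _ _ + ; rewrite addn0; apply: dims_leW.
  by rewrite (comp_unitl' H) // comp_unitl' //; [exact: gl_cpb | exact: gl_dims].
move: im; rewrite leq_eqVlt => /predU1P[E|im].
  rewrite -{m}E in H *.
  have [wU sU dU] := GU; have [wV sV dV] := GV.
  case: (solid_low wU sU) => [lU|hU].
    by rewrite (comp_unitl' H) // comp_unitl' //; [exact: gl_cpb | exact: gl_dims].
  case: (solid_low wV sV) => [lV|hV].
    by rewrite (comp_unitr' H) // comp_unitr' //; [exact: gl_cpb | exact: gl_dims].
  have e : adim (atgt i (tlast U)) = i.
    by rewrite adim_tgt; apply/minn_idPr; rewrite ltnW // -solid_high.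
  rewrite (comp_high sU sV) // gl_cat_gen ?e //; split.
  - by have [+ _ _] := comp_bd H; rewrite (comp_high sU sV).
  - by rewrite solid_cat sU sV e leqnn.
  - by rewrite dims_cat dU dV.
have base U' V' : solid i.+1 U' -> solid i.+1 V' -> good d.+1 i U' -> good d.+1 i V' ->
    cpb m U' V' -> gl d.+1 i (pd_comp m U' V') = pd_comp m (gl d.+1 i U') (gl d.+1 i V').
  move=> sU sV GU' GV' H'; rewrite !gl_solid ?(comp_solid im H') // IHd //; exact: goodS.
move: U V H GU GV; apply: (@comp_ind _ i.+1 m) => // [U V sU sV H GU GV|]; first exact: base.
move=> U b U' V V' sU sV bi H H' L L' I I' GU GV.
have [GU1 bE _ GU2] := good_cat GU bi sU; have [GV1 _ _ GV2] := good_cat GV bi sV.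
have sC : solid i.+1 (pd_comp m U V) by rewrite (comp_solid im H).
rewrite pd_comp_cat ?(cpb_size H) ?bE // !gl_cat // I' // -!gl_solid // base //.
apply/esym/interchange => //; try exact: gl_cpb (ltnW im) _.
- by apply: gl_cat_cpb GU _ _ => //; case: GU1.
- by apply: gl_cat_cpb GV _ _ => //; case: GV1.
Qed.
End GlueTheory.

Lemma gl_eta (X : gset) d i (u : atable X) : good d i u ->
  gl (fun c => (c, [::])) d i u = u.
Proof.
elim: d i u => [|d IHd] i u G; first by rewrite (good0 G) gl1.
elim/(@block_ind X i.+1): u G => [u su G|u b w su bi IH G].
  by rewrite gl_solid // IHd //; apply: goodS.
have [Gu bE L Gw] := good_cat G bi su.
rewrite gl_cat // IH // IHd; last exact: goodS.
have [wu siu _] := Gu; have [ww siw _] := Gw.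
case: L; rewrite bE => l1 l2 l3 l4.
rewrite comp_high // ?l3 //.
by rewrite solid_high.
Qed.

Lemma is_pdE (X : gset) n (u : atable X) : is_pd n u <-> wf u /\ dims_le n u.
Proof. by []. Qed.

Lemma is_pd_src (X : gset) m n (u : atable X) : is_pd n u -> is_pd m (pd_src m u).
Proof. by case=> wu _; split; [exact: wf_src|exact: dims_src]. Qed.
Lemma is_pd_tgt (X : gset) m n (u : atable X) : is_pd n u -> is_pd m (pd_tgt m u).
Proof. by case=> wu _; split; [exact: wf_tgt|exact: dims_tgt]. Qed.

Definition pd (X : gset) (n : nat) : Type := {u : atable X | is_pd n u}.

Lemma pdP (X : gset) n (u v : pd X n) : sval u = sval v -> u = v.
Proof.
case: u v => [u pu] [v pv] /= E; case: v / E pv => pv.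
by congr exist; exact: Prop_irrelevance.
Qed.

(* A pasting scheme is a pasting diagram in the terminal globular set, so that
   T gterm is the globular set of pasting schemes. *)
Program Definition T (X : gset) : gset := @GSet (pd X)
  (fun n u => exist _ (pd_src n (sval u)) (is_pd_src n (svalP u)))
  (fun n u => exist _ (pd_tgt n (sval u)) (is_pd_tgt n (svalP u))) _ _.
Next Obligation.
move=> X n [u [wu du]]; apply: pdP => /=.
by rewrite pd_src_src // pd_src_tgt.
Qed.
Next Obligation.
move=> X n [u [wu du]]; apply: pdP => /=.
by rewrite pd_tgt_tgt // pd_tgt_src.
Qed.

Section Tmap.
Variables (X Y : gset) (f : gmap X Y).
Definition atmap : atable X -> atable Y := tmap (amap f) (amap f).

Lemma tfirst_map u : tfirst (atmap u) = amap f (tfirst u). Proof. by []. Qed.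
Lemma tlast_map u : tlast (atmap u) = amap f (tlast u).
Proof. by rewrite /tlast /= -map_comp -(last_map (amap f)) -map_comp. Qed.
Lemma atmap_cat u b v : atmap (tcat u b v) = tcat (atmap u) (amap f b) (atmap v).
Proof. exact: tmap_cat. Qed.
Lemma solid_map m u : solid m (atmap u) = solid m u.
Proof. by rewrite /solid all_map. Qed.

Lemma is_pd_map n u : is_pd n u -> is_pd n (atmap u).
Proof.
case=> wu du; split; first change (wf (atmap u)).
  elim/table_ind: u wu {du} => [//|a b v IH] /wf_cat[_ L wv].
  rewrite atmap_cat; apply/wf_cat; split=> //; last exact: IH.
  rewrite tfirst_map /=; case: L => l1 l2 l3 l4; split; rewrite ?adim_map //.
    by rewrite atgt_map l3.
  by rewrite asrc_map l4.
move: du; rewrite /tops /= -map_comp all_map => /andP[-> /=].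
by rewrite all_map.
Qed.

Lemma pd_src_map m u : pd_src m (atmap u) = atmap (pd_src m u).
Proof.
have base v : solid m v -> pd_src m (atmap v) = atmap (pd_src m v).
  by move=> sv; rewrite !pd_src_solid ?solid_map // tfirst_map asrc_map.
elim/(@block_ind X m): u => [u|u b v su bm IH]; first exact: base.
by rewrite atmap_cat !pd_src_cat // IH atmap_cat base.
Qed.
Lemma pd_tgt_map m u : pd_tgt m (atmap u) = atmap (pd_tgt m u).
Proof.
have base v : solid m v -> pd_tgt m (atmap v) = atmap (pd_tgt m v).
  by move=> sv; rewrite !pd_tgt_solid ?solid_map // tlast_map atgt_map.
elim/(@block_ind X m): u => [u|u b v su bm IH]; first exact: base.
by rewrite atmap_cat !pd_tgt_cat // IH atmap_cat base.
Qed.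

Lemma blocks_map m u : pd_blocks m (atmap u) = tmap (amap f) atmap (pd_blocks m u).
Proof. exact: tcut_map. Qed.
Lemma pd_join_map m u v : pd_join m (atmap u) (atmap v) = atmap (pd_join m u v).
Proof.
rewrite /pd_join !tfirst_map !adim_map; case: ifP => // _; case: ifP => // _.
by rewrite atmap_cat tlast_map atgt_map.
Qed.
Lemma pd_comp_map m u v : pd_comp m (atmap u) (atmap v) = atmap (pd_comp m u v).
Proof.
rewrite /pd_comp !blocks_map; move: (pd_blocks m u) (pd_blocks m v) => [z l] [w l'].
rewrite /tzip /tflatten /= pd_join_map /atmap /tmap /= map_cat; congr (_, _ ++ _).
elim: l l' => [|p l IH] [|p' l'] //=; rewrite map_cat -IH /=.
by rewrite pd_join_map.
Qed.
Lemma pd_glue_map d m U : pd_glue d m (tmap id atmap U) = atmap (pd_glue d m U).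
Proof.
elim: d m U => [//|d IH] m U /=; rewrite tcut_map.
have -> : tmap id (pd_glue d m.+1) (tmap id (tmap id atmap) (tcut (fun i => i < m.+1) U))
   = tmap id atmap (tmap id (pd_glue d m.+1) (tcut (fun i => i < m.+1) U)).
  rewrite /tmap /= IH -!map_comp; congr (_, _).
  by apply: eq_map => p /=; rewrite IH.
elim/table_ind: (tmap id (pd_glue d m.+1) _) => [//|e s v I].
by rewrite tmap_cat !tfold_cat1 I pd_comp_map.
Qed.
End Tmap.

Definition pd_map (X Y : gset) (f : gmap X Y) n (u : T X n) : T Y n :=
  exist _ (atmap f (sval u)) (is_pd_map f (svalP u)).

Program Definition Tmap (X Y : gset) (f : gmap X Y) : gmap (T X) (T Y) :=
  @GMap (T X) (T Y) (@pd_map X Y f) _ _.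
Next Obligation. by move=> X Y f n u; apply: pdP; rewrite /= pd_src_map. Qed.
Next Obligation. by move=> X Y f n u; apply: pdP; rewrite /= pd_tgt_map. Qed.

Lemma asrc_acell (X : gset) n (x : X n.+1) : asrc n (acell x) = acell (src x).
Proof. by rewrite /asrc subSnn. Qed.
Lemma atgt_acell (X : gset) n (x : X n.+1) : atgt n (acell x) = acell (tgt x).
Proof. by rewrite /atgt subSnn. Qed.

Lemma is_pd1 (X : gset) n (x : X n) : is_pd n (acell x, [::]).
Proof. by split=> //=; rewrite leqnn. Qed.

Program Definition Teta (X : gset) : gmap X (T X) :=
  @GMap X (T X) (fun n x => exist _ (acell x, [::]) (is_pd1 x)) _ _.
Next Obligation. by move=> X n x; apply: pdP; rewrite /= pd_src_solid //= asrc_acell. Qed.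
Next Obligation. by move=> X n x; apply: pdP; rewrite /= pd_tgt_solid //= atgt_acell. Qed.

Definition pdval (X : gset) (c : anycell (T X)) : atable X := sval (projT2 c).

Lemma pdval_wf (X : gset) (c : anycell (T X)) : wf (pdval c).
Proof. by case: c => n [u []]. Qed.
Lemma pdval_dims (X : gset) (c : anycell (T X)) : dims_le (adim c) (pdval c).
Proof. by case: c => n [u []]. Qed.

Lemma pdval_src (X : gset) m (c : anycell (T X)) : pdval (asrc m c) = pd_src m (pdval c).
Proof.
case: (leqP (adim c) m) => [le|lt].
  rewrite asrc_id // pd_src_id //; first exact: pdval_wf.
  exact: dims_leW le (pdval_dims c).
have E i : pdval (iter i (@asrc1 (T X)) c) = pd_src (adim c - i) (pdval c).
  elim: i => [|i IH]; first by rewrite subn0 pd_src_id //; [exact: pdval_wf|exact: pdval_dims].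
  have D := adim_iter_src1 i c; rewrite iterS.
  move: D IH; case: (iter i _ c) => -[|n] x /= D IH.
    by rewrite subnS -D; move: IH; rewrite -D.
  by rewrite -[LHS]/(pd_src n (pdval (existT _ n.+1 x))) IH subnS -D /= pd_src_src.
by rewrite /asrc E; congr pd_src; rewrite subKn // ltnW.
Qed.
Lemma pdval_tgt (X : gset) m (c : anycell (T X)) : pdval (atgt m c) = pd_tgt m (pdval c).
Proof.
case: (leqP (adim c) m) => [le|lt].
  rewrite atgt_id // pd_tgt_id //; first exact: pdval_wf.
  exact: dims_leW le (pdval_dims c).
have E i : pdval (iter i (@atgt1 (T X)) c) = pd_tgt (adim c - i) (pdval c).
  elim: i => [|i IH]; first by rewrite subn0 pd_tgt_id //; [exact: pdval_wf|exact: pdval_dims].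
  have D := adim_iter_tgt1 i c; rewrite iterS.
  move: D IH; case: (iter i _ c) => -[|n] x /= D IH.
    by rewrite subnS -D; move: IH; rewrite -D.
  by rewrite -[LHS]/(pd_tgt n (pdval (existT _ n.+1 x))) IH subnS -D /= pd_tgt_tgt.
by rewrite /atgt E; congr pd_tgt; rewrite subKn // ltnW.
Qed.

Lemma good_pd (Y : gset) n (u : atable Y) : is_pd n u -> good n 0 u.
Proof. by case=> wu du; split=> //; apply: all_predT. Qed.

Definition pd_flat (X : gset) n (U : atable (T X)) : atable X :=
  pd_glue n 0 (tmap (@adim (T X)) (@pdval X) U).

Lemma pd_flat_gl (X : gset) n (U : atable (T X)) : pd_flat n U = gl (@pdval X) n 0 U.
Proof. by []. Qed.

Lemma is_pd_flat (X : gset) n (U : atable (T X)) : is_pd n U -> is_pd n (pd_flat n U).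
Proof.
move=> pU; have G := good_pd pU; case: pU => wU dU.
have [s t] := (@pdval_src X, @pdval_tgt X).
split; first exact: (gl_wf (@pdval_wf X) s t G).
exact: (gl_dims (@pdval_wf X) s t G).
Qed.

Program Definition Tmu (X : gset) : gmap (T (T X)) (T X) :=
  @GMap (T (T X)) (T X) (fun n U => exist _ (pd_flat n (sval U)) (is_pd_flat (svalP U))) _ _.
Next Obligation.
move=> X n [U pU]; apply: pdP => /=; rewrite !pd_flat_gl; have G := good_pd pU.
have [s t] := (@pdval_src X, @pdval_tgt X).
rewrite (gl_src (@pdval_wf X) s t G) //; apply: gl_lift => //.
by apply: good_pd; apply: is_pd_src pU.
Qed.
Next Obligation.
move=> X n [U pU]; apply: pdP => /=; rewrite !pd_flat_gl; have G := good_pd pU.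
have [s t] := (@pdval_src X, @pdval_tgt X).
rewrite (gl_tgt (@pdval_wf X) s t G) //; apply: gl_lift => //.
by apply: good_pd; apply: is_pd_tgt pU.
Qed.

Lemma gl_gl (X : gset) n d i (W : atable (T (T X))) : good d i W -> dims_le n W ->
  gl (@pdval X) n 0 (gl (@pdval (T X)) d i W) =
  gl (fun c => pdval (amap (Tmu X) c)) d i W.
Proof.
have [s t] := (@pdval_src (T X), @pdval_tgt (T X)); have w := @pdval_wf (T X).
have [s' t'] := (@pdval_src X, @pdval_tgt X); have w' := @pdval_wf X.
elim: d i W => [|d IHd] i W G dW.
  rewrite (good0 G) !gl1 -[RHS]/(gl (@pdval X) (adim (tfirst W)) 0 (pdval (tfirst W))).
  symmetry; apply: gl_lift (dims_first dW) _.
  by split; [exact: pdval_wf|exact: all_predT|exact: pdval_dims].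
elim/(@block_ind (T (T X)) i.+1): W G dW => [W sW|U b W sU bi IH] G dW.
  by rewrite !(gl_solid _ _ sW) IHd //; apply: goodS.
have [GU bE L GW] := good_cat G bi sU.
move: dW; rewrite dims_cat => /andP[dU dW].
have siU : solid i U by case: GU.
have H := gl_cat_cpb w s t G siU bi.
rewrite !(gl_cat _ _ _ sU bi) -(IH GW dW) -(IHd _ _ (goodS GU sU) dU).
rewrite (gl_solid _ _ sU) in H.
have good_gl k j V : good k j V -> dims_le n V -> good n 0 (gl (@pdval (T X)) k j V).
  move=> GV dV; split; [exact: gl_wf|exact: all_predT|].
  have [le|/ltnW le] := leqP j n; first exact: gl_dims.
  have [wV sV _] := GV; have lV := dims_leW le dV.
  by rewrite (solid_dims wV sV lV) gl1; apply: dims_leW (pdval_dims _); apply: dims_first.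
by apply: gl_comp => //; apply: good_gl => //; apply: goodS.
Qed.

Record functor : Type := Functor {
  fob :> gset -> gset;
  fmap : forall X Y, gmap X Y -> gmap (fob X) (fob Y);
  fmap_id : forall X, fmap (gid X) = gid (fob X);
  fmap_comp : forall X Y Z (g : gmap Y Z) (f : gmap X Y),
    fmap (g \og f) = fmap g \og fmap f }.

Record monad : Type := Monad {
  mfun :> functor;
  eta : forall X, gmap X (mfun X);
  mu : forall X, gmap (mfun (mfun X)) (mfun X);
  eta_nat : forall X Y (f : gmap X Y), fmap mfun f \og eta X = eta Y \og f;
  mu_nat : forall X Y (f : gmap X Y),
    fmap mfun f \og mu X = mu Y \og fmap mfun (fmap mfun f);
  mu_eta : forall X, mu X \og eta (mfun X) = gid (mfun X);
  mu_map_eta : forall X, mu X \og fmap mfun (eta X) = gid (mfun X);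
  mu_mu : forall X, mu X \og mu (mfun X) = mu X \og fmap mfun (mu X) }.

Lemma amap_id (X : gset) (c : anycell X) : amap (gid X) c = c.
Proof. by case: c. Qed.

Program Definition T_functor : functor := @Functor T Tmap _ _.
Next Obligation.
move=> X; apply: gmapP => n [[a l] pu]; apply: pdP => /=.
rewrite /atmap /tmap /= amap_id -[RHS]/(a, l); congr (_, _).
by rewrite -[RHS]map_id; apply: eq_map => -[b c] /=; rewrite !amap_id.
Qed.
Next Obligation.
move=> X Y Z g f; apply: gmapP => n [[a l] pu]; apply: pdP => /=.
by rewrite /atmap /tmap /= -map_comp.
Qed.

Program Definition T_monad : monad := @Monad T_functor Teta Tmu _ _ _ _ _.
Next Obligation. by move=> X Y f; apply: gmapP => n x; apply: pdP. Qed.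
Next Obligation.
move=> X Y f; apply: gmapP => n U; apply: pdP => /=.
rewrite /pd_flat -pd_glue_map; congr pd_glue.
by rewrite /tmap /= -!map_comp.
Qed.
Next Obligation.
move=> X; apply: gmapP => n u; apply: pdP => /=.
by rewrite pd_flat_gl gl1.
Qed.
Next Obligation.
move=> X; apply: gmapP => n u; apply: pdP => /=.
rewrite -[RHS](gl_eta (good_pd (svalP u))) /pd_flat /gl.
have E (c : anycell X) : pdval (amap (Teta X) c) = (c, [::]) by case: c.
congr pd_glue; rewrite /atmap /tmap /= -map_comp E; congr (_, _).
by apply: eq_map => p /=; rewrite E.
Qed.
Next Obligation.
move=> X; apply: gmapP => n W; apply: pdP => /=.
rewrite !pd_flat_gl gl_gl; [|exact: good_pd (svalP W)|by case: (svalP W)].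
by rewrite /gl; congr pd_glue; rewrite /atmap /tmap /= -!map_comp.
Qed.

Definition is_monad_morphism (P Q : monad) (alpha : forall X, gmap (P X) (Q X)) :
    Prop :=
  [/\ forall X Y (f : gmap X Y), fmap Q f \og alpha X = alpha Y \og fmap P f,
      forall X, alpha X \og eta P X = eta Q X &
      forall X, alpha X \og mu P X = mu Q X \og fmap Q (alpha X) \og alpha (P X)].

(* A morphism from the boundary of the (n+1)-globe to P1 is given as a
   parallel pair (f, g) of n-cells of P1, and one from the (n+1)-globe to T1
   as an (n+1)-cell k of T1; the two agree on the boundary when ar f and ar g
   are the source and the target of k. *)
Record cmc : Type := Cmc {
  cmonad :> monad;
  ar : forall X, gmap (cmonad X) (T X);
  ar_morphism : is_monad_morphism (Q := T_monad) ar;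
  ar_cartesian : forall X Y (f : gmap X Y),
    is_pullback (fmap cmonad f) (ar X) (ar Y) (Tmap f);
  kappa : forall n (f g : cmonad gterm n) (k : T gterm n.+1),
    parallel f g -> ar gterm n f = src k -> ar gterm n g = tgt k ->
    cmonad gterm n.+1;
  kappa_src : forall n f g k fg fk gk, src (@kappa n f g k fg fk gk) = f;
  kappa_tgt : forall n f g k fg fk gk, tgt (@kappa n f g k fg fk gk) = g;
  kappa_ar : forall n f g k fg fk gk,
    ar gterm n.+1 (@kappa n f g k fg fk gk) = k }.

Definition is_cmc_morphism (P Q : cmc) (alpha : forall X, gmap (P X) (Q X)) :
    Prop :=
  [/\ is_monad_morphism alpha,
      forall X, ar Q X \og alpha X = ar P X &
      forall n (f g : P gterm n) (k : T gterm n.+1) fg fk gk fg' fk' gk',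
        alpha gterm n.+1 (@kappa P n f g k fg fk gk) =
        @kappa Q n (alpha gterm n f) (alpha gterm n g) k fg' fk' gk'].

Definition is_initial (L : cmc) : Prop :=
  forall Q : cmc, exists! alpha : forall X, gmap (L X) (Q X),
    is_cmc_morphism alpha.

Record algebra (P : monad) : Type := Algebra {
  acarrier :> gset;
  act : gmap (P acarrier) acarrier;
  act_eta : act \og eta P acarrier = gid acarrier;
  act_mu : act \og mu P acarrier = act \og fmap P act }.

Program Definition gfibre (X Y Z : gset) (f : gmap X Z) (g : gmap Y Z) : gset :=
  @GSet (fun n => {c : X n * Y n | f n c.1 = g n c.2})
    (fun n c => exist _ (src (sval c).1, src (sval c).2) _)
    (fun n c => exist _ (tgt (sval c).1, tgt (sval c).2) _) _ _.
Next Obligation. by move=> X Y Z f g n [[x y] /= e]; rewrite !gfun_src e. Qed.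
Next Obligation. by move=> X Y Z f g n [[x y] /= e]; rewrite !gfun_tgt e. Qed.
Next Obligation.
by move=> X Y Z f g n [[x y] /= e]; apply: eq_exist; rewrite /= !src_src.
Qed.
Next Obligation.
by move=> X Y Z f g n [[x y] /= e]; apply: eq_exist; rewrite /= !tgt_src.
Qed.

Lemma pullback_cell (W X Y Z : gset) (p : gmap W X) (q : gmap W Y)
    (f : gmap X Z) (g : gmap Y Z) : is_pullback p q f g ->
  forall n (x : X n) (y : Y n), f n x = g n y ->
  exists! w : W n, p n w = x /\ q n w = y.
Proof.
case=> sq up n x y e.
pose F := gfibre f g.
pose p1 : gmap F X := @GMap F X (fun _ c => (sval c).1) (fun _ _ => erefl) (fun _ _ => erefl).
pose p2 : gmap F Y := @GMap F Y (fun _ c => (sval c).2) (fun _ _ => erefl) (fun _ _ => erefl).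
have [h [[hp hq] _]] : exists! h : gmap F W, p \og h = p1 /\ q \og h = p2.
  by apply: up; apply: gmapP => k c; exact: svalP c.
have hE k (c : F k) : p k (h k c) = (sval c).1 /\ q k (h k c) = (sval c).2.
  by rewrite -[LHS]/((p \og h) k c) -[q k _]/((q \og h) k c) hp hq.
have pq k (w : W k) : f k (p k w) = g k (q k w).
  by rewrite -[LHS]/((f \og p) k w) sq.
have [i iE] : exists i : gmap W F, forall k w, sval (i k w) = (p k w, q k w).
  unshelve eexists (@GMap W F (fun k w => exist _ (p k w, q k w) (pq k w)) _ _);
    by move=> k w //; apply: eq_exist; rewrite /= ?gfun_src ?gfun_tgt.
have hi : h \og i = gid W.
  have [j [_ uj]] := up W p q sq.
  rewrite -(uj (h \og i)) ?(uj (gid W)) //; first by split; exact: gmapP.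
  by split; apply: gmapP => k w /=; case: (hE k (i k w)); rewrite iE.
exists (h n (exist _ (x, y) e)); split=> [|w [wx wy]]; first exact: (hE n (exist _ (x, y) e)).
rewrite -[RHS]/(gid W n w) -hi /=; congr (h n _).
by case: (i n w) (iE n w) => c ec /= cE; apply: eq_exist; rewrite cE wx wy.
Qed.

(* PX is the pullback of T! and ar, so that its n-cells are the pairs (phi, u)
   with phi an n-cell of P1 and u a pasting diagram of shape ar phi. *)
Definition pcell (P : cmc) (X : gset) n (phi : P gterm n) (u : T X n)
    (h : ar P gterm n phi = Tmap (bang X) n u) : P X n :=
  sval (cid (pullback_cell (ar_cartesian P (bang X)) h)).
Arguments pcell {P X n} phi u h.

Lemma pcell_spec (P : cmc) (X : gset) n (phi : P gterm n) (u : T X n) h :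
  fmap P (bang X) n (pcell phi u h) = phi /\ ar P X n (pcell phi u h) = u.
Proof. by rewrite /pcell; case: cid => w []. Qed.

(* The one-entry diagram [x] as a cell of TX of dimension one more than x *)
Program Definition pd_deg (X : gset) n (x : X n) : T X n.+1 :=
  exist _ (acell x, [::]) _.
Next Obligation. by move=> X n x; split=> //=; rewrite leqnSn. Qed.

Program Definition pd_pair (X : gset) n (u v : X n.+1) (uv : tgt u = src v) :
    T X n.+1 := exist _ (acell u, [:: (acell (tgt u), acell v)]) _.
Next Obligation.
move=> X n u v uv; split=> //=; last by rewrite leqnn.
by split=> //; split=> //=; rewrite ?atgt_acell ?asrc_acell ?uv.
Qed.

Lemma T1_src_tgt n (k : T gterm n.+1) : src k = tgt k.
Proof.
apply: pdP => /=; case: k => u [wu _] /=.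
have E (b c : anycell gterm) : adim b = adim c -> b = c.
  by case: b c => [i []] [j []] /= ->.
have base (v : atable gterm) : wf v -> solid n v -> pd_src n v = pd_tgt n v.
  move=> wv sv; rewrite pd_src_solid // pd_tgt_solid //.
  rewrite (E (asrc n (tfirst v)) (atgt n (tlast v))) // adim_src adim_tgt.
  case: (solid_dim wv sv) => [->//|[a b]].
  by rewrite (minn_idPr (ltnW a)) (minn_idPr (ltnW b)).
elim/(@block_ind gterm n): u wu => [u su wu|u b v su bn IH /wf_cat[wu _ wv]].
  exact: base.
by rewrite pd_src_cat // pd_tgt_cat // base // IH.
Qed.

Lemma T1_dim0 (k : T gterm 0) : k = Teta gterm 0 tt.
Proof.
apply: pdP => /=; case: k => u [wu du] /=.
rewrite (solid_dims wu _ du); last exact: all_predT.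
move: (dims_first du).
by case: (tfirst u) => -[|i] [].
Qed.

Section StandardPasting.
Variable P : cmc.

Definition etilde n : P gterm n := eta P gterm n tt.

Lemma ar_etilde n : ar P gterm n (etilde n) = Teta gterm n tt.
Proof.
have [_ E _] := ar_morphism P.
by rewrite -[LHS]/((ar P gterm \og eta P gterm) n tt) E.
Qed.

Lemma parallel_refl (X : gset) n (x : X n) : parallel x x.
Proof. by case: n x. Qed.

Fixpoint sp_rec n : forall k : T gterm n, {phi : P gterm n | ar P gterm n phi = k} :=
  match n with
  | 0 => fun k => exist _ (etilde 0) (etrans (ar_etilde 0) (esym (T1_dim0 k)))
  | n'.+1 => fun k =>
      match pselect (k = Teta gterm n'.+1 tt) with
      | left E => exist _ (etilde n'.+1) (etrans (ar_etilde n'.+1) (esym E))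
      | right _ => let phi := sp_rec (src k) in
          exist _
            (kappa (parallel_refl (sval phi)) (svalP phi)
                   (etrans (svalP phi) (T1_src_tgt k)))
            (kappa_ar _ _ _)
      end
  end.

Definition sp n (k : T gterm n) : P gterm n := sval (sp_rec k).

Lemma ar_sp n (k : T gterm n) : ar P gterm n (sp k) = k.
Proof. exact: svalP (sp_rec k). Qed.

Variable A : algebra P.

Lemma deg_shape n (x : A n) :
  ar P gterm n.+1 (sp (pd_deg (tt : gterm n))) = Tmap (bang A) n.+1 (pd_deg x).
Proof. by rewrite ar_sp; apply: pdP. Qed.

Lemma pair_shape n (u v : A n.+1) (uv : tgt u = src v) :
  ar P gterm n.+1 (sp (@pd_pair gterm n tt tt erefl)) =
  Tmap (bang A) n.+1 (pd_pair uv).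
Proof. by rewrite ar_sp; apply: pdP. Qed.

Definition idc n (x : A n) : A n.+1 :=
  act A n.+1 (pcell (sp (pd_deg (tt : gterm n))) (pd_deg x) (deg_shape x)).

Definition compc n (u v : A n.+1) (uv : tgt u = src v) : A n.+1 :=
  act A n.+1
    (pcell (sp (@pd_pair gterm n tt tt erefl)) (pd_pair uv) (pair_shape uv)).
Arguments compc {n} u v uv.

Definition inv_step (S : forall n, A n -> Prop) n : A n -> Prop :=
  match n with
  | 0 => fun _ => False
  | n'.+1 => fun u =>
      exists (v : A n'.+1) (uv : tgt u = src v) (vu : tgt v = src u),
        (exists p : A n'.+2,
           [/\ src p = compc u v uv, tgt p = idc (src u) & S n'.+2 p]) /\
        (exists q : A n'.+2,
           [/\ src q = compc v u vu, tgt q = idc (tgt u) & S n'.+2 q])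
  end.

(* The union of all S contained in inv_step S, that is, the greatest fixed
   point of inv_step. *)
Definition invertible n (x : A n) : Prop :=
  exists S : forall n, A n -> Prop,
    (forall m (y : A m), S m y -> inv_step S y) /\ S n x.

(* The top entries of dimension n of the n-cell u of TA *)
Definition fdl n (u : T A n) (x : A n) : Prop := List.In (acell x) (tops (sval u)).

Definition pst (S : forall n, A n -> Prop) n (x : A n) : Prop :=
  exists (phi : P gterm n) (u : T A n) (h : ar P gterm n phi = Tmap (bang A) n u),
    (forall y, fdl u y -> S n y) /\ x = act A n (pcell phi u h).
End StandardPasting.

(* Main.v *)
From mathcomp Require Import all_boot.
From mathcomp Require Import boolp zify.
Require Import Defs.

(** Let W be the closure of the set I of invertible cells under pasting.  It is
    enough to prove that every cell of W has an inverse with witnesses in W: then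
    W is contained in the greatest fixed point, which is I, and pst(I) lies in W.
    The proof is by induction on the construction of a cell of W, so let
    x = act c be the value of an instruction c over a diagram u whose (m+1)-cells
    have inverses with witnesses in W (act_inverse).

    The diagram u has an inverse diagram u': cut u at its bottom entries of
    dimension below m, and reverse each of the resulting chains of (m+1)-cells,
    replacing every cell by its inverse (chain_inverse, table_inverseP).  The
    contraction gives an instruction d over u' in the direction opposite to c, and
    the inverse of x is y = act d.  The composite of x and y is the value of an
    instruction over u * u' (act_comp_cell), while the identity of the source of x
    is the value of one over the source of u seen as an identity (act_id_cell).
    What remains is to produce a cell of W from the first value to the second.

    Two facts about W produce such cells.  By the contraction, the values of two
    parallel instructions over the same diagram are joined by coherence cells,
    which are values of diagrams without top-dimensional entry (below_coherence);
    more generally any (m+2)-diagram whose (m+2)-cells are in W joins the values over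
    its source and its target (below_fill).  In particular the value of a diagram of
    diagrams may be replaced by a diagram of values (act_glue).  For a chain the
    cells cancel one after the other from the middle, as in a category
    (pd_cancel_comp).  For general u the cancellations of the different chains are
    performed simultaneously: the diagram of the composites of the chains is the
    source of a single (m+2)-diagram, whose entries are the comparison cells of the
    chains (step, step_cat, step_below).  Replacing chains by their composites does
    not disturb the boundary, since each of the chains is bounded by single
    m-cells (gl_flat, glue_eta). *)

Set Implicit Arguments.
Unset Strict Implicit.
Unset Printing Implicit Defensive.

(** * Evaluating equations of globular maps *)

Lemma gmap_ap (X Y : gset) (f g : gmap X Y) : f = g ->
  forall n (x : X n), f n x = g n x.
Proof. by move=> ->. Qed.

Lemma parallel_gmap (X Y : gset) (f : gmap X Y) n (x y : X n) :
  parallel x y -> parallel (f n x) (f n y).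
Proof. by case: n x y => // n x y [xy yx]; rewrite /= -!gfun_src -!gfun_tgt xy yx. Qed.

Lemma parallel_src_tgt (X : gset) n (x : X n.+1) : parallel (src x) (tgt x).
Proof. by case: n x => // n x; split; rewrite ?src_src ?tgt_src. Qed.

(** * The cells of a cartesian monad over T *)

Section OverT.
Variable P : cmc.

Lemma ar_natural (X Y : gset) (f : gmap X Y) n (c : P X n) :
  ar P Y n (fmap P f n c) = Tmap f n (ar P X n c).
Proof. by have [E _ _] := ar_morphism P; exact: esym (gmap_ap (E X Y f) c). Qed.

Lemma ar_eta (X : gset) n (x : X n) : ar P X n (eta P X n x) = Teta X n x.
Proof. by have [_ E _] := ar_morphism P; exact: gmap_ap (E X) n x. Qed.

Lemma ar_mu (X : gset) n (c : P (P X) n) :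
  ar P X n (mu P X n c) = Tmu X n (Tmap (ar P X) n (ar P (P X) n c)).
Proof. by have [_ _ E] := ar_morphism P; exact: gmap_ap (E X) n c. Qed.

Lemma fmap_ap (X Y Z : gset) (g : gmap Y Z) (f : gmap X Y) n (c : P X n) :
  fmap P g n (fmap P f n c) = fmap P (g \og f) n c.
Proof. by rewrite fmap_comp. Qed.

(** Cells of PX are pairs of an instruction in P1 and a diagram in TX, because
    PX is a pullback; below, cells of PX are handled through ar alone, and pairs
    only appear where the standard instructions enter. *)
Lemma pcell_inj (X : gset) n (c d : P X n) :
  fmap P (bang X) n c = fmap P (bang X) n d -> ar P X n c = ar P X n d -> c = d.
Proof.
move=> cd acd; have H : ar P gterm n (fmap P (bang X) n d) =
    Tmap (bang X) n (ar P X n d) by exact: ar_natural.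
have [w [_ U]] := pullback_cell (ar_cartesian P (bang X)) H.
by rewrite -(U c) ?(U d).
Qed.

Lemma pcellE (X : gset) n phi (u : T X n) h (c : P X n) :
  fmap P (bang X) n c = phi -> ar P X n c = u -> @pcell P X n phi u h = c.
Proof.
by move=> cp cu; have [wp wu] := pcell_spec h; apply: pcell_inj; rewrite ?wp ?wu.
Qed.

(** The contraction on P1 lifts to a contraction on every ar_X: the lift is the
    pair of the cell chosen by kappa and the prescribed diagram. *)
Lemma contraction (X : gset) n (c d : P X n) (w : T X n.+1) : parallel c d ->
  ar P X n c = src w -> ar P X n d = tgt w ->
  exists z : P X n.+1, [/\ src z = c, tgt z = d & ar P X n.+1 z = w].
Proof.
move=> cd cw dw.
have ec : ar P gterm n (fmap P (bang X) n c) = src (Tmap (bang X) n.+1 w).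
  by rewrite ar_natural cw gfun_src.
have ed : ar P gterm n (fmap P (bang X) n d) = tgt (Tmap (bang X) n.+1 w).
  by rewrite ar_natural dw gfun_tgt.
have pcd := parallel_gmap (fmap P (bang X)) cd.
have ek := kappa_ar pcd ec ed.
have [zk zw] := pcell_spec ek.
exists (pcell _ _ ek); split=> //; apply: pcell_inj.
- by rewrite gfun_src zk kappa_src.
- by rewrite gfun_src zw.
- by rewrite gfun_tgt zk kappa_tgt.
- by rewrite gfun_tgt zw.
Qed.

Lemma sp_unit n : sp P (Teta gterm n tt) = etilde P n.
Proof. by case: n => //= n; rewrite /sp /=; case: pselect => // -[]. Qed.

(** Being built by recursion on boundaries, sp is a map of globular sets; the
    exceptional value on the unit scheme is compatible since the boundary of a
    unit scheme is again one. *)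
Lemma sp_srctgt n (k : T gterm n.+1) :
  src (sp P k) = sp P (src k) /\ tgt (sp P k) = sp P (src k).
Proof.
rewrite {1 3}/sp; cbn [sp_rec]; case: pselect => [E|ne]; cbn [sval].
  have -> : src k = Teta gterm n tt by rewrite E -(gfun_src (Teta gterm)).
  by rewrite sp_unit /etilde -gfun_src -gfun_tgt.
by rewrite kappa_src kappa_tgt.
Qed.

Fact sec_shape (X : gset) n (u : T X n) :
  ar P gterm n (sp P (Tmap (bang X) n u)) = Tmap (bang X) n u.
Proof. exact: ar_sp. Qed.

Fact sec_src (X : gset) n (u : T X n.+1) :
  pcell _ _ (sec_shape (src u)) = src (pcell _ _ (sec_shape u)).
Proof.
have [zk zw] := pcell_spec (sec_shape u); apply: pcellE.
  by rewrite gfun_src zk (sp_srctgt _).1 gfun_src.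
by rewrite gfun_src zw.
Qed.

Fact sec_tgt (X : gset) n (u : T X n.+1) :
  pcell _ _ (sec_shape (tgt u)) = tgt (pcell _ _ (sec_shape u)).
Proof.
have [zk zw] := pcell_spec (sec_shape u); apply: pcellE.
  by rewrite gfun_tgt zk (sp_srctgt _).2 gfun_tgt T1_src_tgt.
by rewrite gfun_tgt zw.
Qed.

(** The natural section of ar_X given by the standard instructions. *)
Definition sec (X : gset) : gmap (T X) (P X) :=
  @GMap (T X) (P X) (fun n u => pcell _ _ (sec_shape u)) (@sec_src X) (@sec_tgt X).

Lemma ar_sec (X : gset) n (u : T X n) : ar P X n (sec X n u) = u.
Proof. by have [] := pcell_spec (sec_shape u). Qed.

Lemma bang_sec (X : gset) n (u : T X n) :
  fmap P (bang X) n (sec X n u) = sp P (Tmap (bang X) n u).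
Proof. by have [] := pcell_spec (sec_shape u). Qed.

Lemma Tmap_ap (X Y Z : gset) (g : gmap Y Z) (f : gmap X Y) n (u : T X n) :
  Tmap g n (Tmap f n u) = Tmap (g \og f) n u.
Proof. by rewrite (gmap_ap (@fmap_comp T_functor _ _ _ g f)). Qed.

Lemma sec_natural (X Y : gset) (f : gmap X Y) n (u : T X n) :
  fmap P f n (sec X n u) = sec Y n (Tmap f n u).
Proof.
apply/esym/pcellE; last by rewrite ar_natural ar_sec.
rewrite fmap_ap Tmap_ap (_ : _ \og f = bang X) ?bang_sec //; exact: gmapP.
Qed.

Lemma sec_eta (X : gset) n (x : X n) : sec X n (Teta X n x) = eta P X n x.
Proof.
apply: pcellE; last exact: ar_eta.
apply: etrans (gmap_ap (eta_nat P (bang X)) x) _.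
by rewrite -[LHS]/(etilde P n) -(sp_unit n); congr sp; apply: pdP.
Qed.

Variable A : algebra P.

(** The standard composite of a pasting diagram.  It is only a map of globular
    sets, not an algebra of T: coherence cells measure the failure. *)
Definition eval : gmap (T A) A := act A \og sec A.

Lemma eval_eta n (x : A n) : eval n (Teta A n x) = x.
Proof.
rewrite -[LHS]/(act A n (sec A n (Teta A n x))) sec_eta.
exact: gmap_ap (act_eta A) n x.
Qed.

Lemma idcE n (x : A n) : idc x = eval n.+1 (pd_deg x).
Proof.
congr (act A n.+1 _); apply: pcellE (ar_sec _).
by rewrite bang_sec; congr sp; apply: pdP.
Qed.

Lemma compcE n (u v : A n.+1) (uv : tgt u = src v) :
  compc uv = eval n.+1 (pd_pair uv).
Proof.
congr (act A n.+1 _); apply: pcellE (ar_sec _).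
by rewrite bang_sec; congr sp; apply: pdP.
Qed.

(** Turns an instruction for a diagram of diagrams into one for the glued
    diagram, each inner diagram being composed in the standard way. *)
Definition glue : gmap (P (T A)) (P A) := mu P A \og fmap P (sec A).

(** Evaluating a diagram whose entries are standard composites is the same as
    evaluating the glued diagram along another instruction. *)
Lemma act_glue n (g : P (T A) n) :
  act A n (fmap P eval n g) = act A n (glue n g).
Proof. by rewrite -fmap_ap; exact: esym (gmap_ap (act_mu A) _). Qed.

Lemma Tmap_id (X : gset) n (u : T X n) : Tmap (gid X) n u = u.
Proof. exact: gmap_ap (@fmap_id T_functor X) n u. Qed.

Lemma ar_glue n (g : P (T A) n) :
  ar P A n (glue n g) = Tmu A n (ar P (T A) n g).
Proof.
rewrite /= ar_mu ar_natural Tmap_ap (_ : _ \og _ = gid (T A)) ?Tmap_id //.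
by apply: gmapP => k u; apply: ar_sec.
Qed.

(** Since sec preserves units, gluing does not change an instruction whose
    entries are single generators.  This keeps boundaries under control. *)
Lemma glue_eta n (c : P A n) : glue n (fmap P (Teta A) n c) = c.
Proof.
rewrite /= fmap_ap (_ : _ \og _ = eta P A); last by apply: gmapP => k x; apply: sec_eta.
exact: gmap_ap (mu_map_eta P A) n c.
Qed.

End OverT.

(** * Diagrams with one or two top entries *)

Lemma acell_inj (X : gset) n : injective (@acell X n).
Proof.
move=> x y e; have := projT2_eq e; move: (projT1_eq e) => /= E.
by rewrite (eq_irrelevance E erefl).
Qed.

Section PairDiagrams.
Variable X : gset.

Lemma pair_src n (u v : X n.+1) (uv : tgt u = src v) :
  src (pd_pair uv) = Teta X n (src u).
Proof. by apply: pdP; rewrite /= pd_src_solid ?asrc_acell //= /solid /= leqnn. Qed.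

Lemma pair_tgt n (u v : X n.+1) (uv : tgt u = src v) :
  tgt (pd_pair uv) = Teta X n (tgt v).
Proof. by apply: pdP; rewrite /= pd_tgt_solid ?atgt_acell //= /solid /= leqnn. Qed.

Lemma deg_src n (x : X n) : src (pd_deg x) = Teta X n x.
Proof. by apply: pdP; rewrite /= pd_src_solid //= asrc_id. Qed.

Lemma deg_tgt n (x : X n) : tgt (pd_deg x) = Teta X n x.
Proof. by apply: pdP; rewrite /= pd_tgt_solid //= atgt_id. Qed.

Lemma pair_eq n (u v u' v' : X n.+1) (uv : tgt u = src v) (uv' : tgt u' = src v') :
  u = u' -> v = v' -> pd_pair uv = pd_pair uv'.
Proof. by move=> eu ev; apply: pdP; rewrite /= eu ev. Qed.

Lemma Tmap_pair (Y : gset) (f : gmap X Y) n (u v : X n.+1) (uv : tgt u = src v)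
    (fuv : tgt (f _ u) = src (f _ v)) :
  Tmap f n.+1 (pd_pair uv) = pd_pair fuv.
Proof. by apply: pdP; rewrite /= /atmap /tmap /amap /= gfun_tgt. Qed.

Lemma Tmap_deg (Y : gset) (f : gmap X Y) n (x : X n) :
  Tmap f n.+1 (pd_deg x) = pd_deg (f n x).
Proof. exact: pdP. Qed.

(** Two (n+2)-cells side by side along dimension n: a diagram whose source and
    target are composable pairs of (n+1)-cells. *)
Lemma par_pair_pd n (p q : X n.+2) (pq : tgt (src p) = src (src q)) :
  is_pd n.+2 (acell p, [:: (acell (tgt (src p)), acell q)]).
Proof.
split; last by rewrite /= leqnn.
split=> //; split=> //=.
  by rewrite -(atgt_tgt _ (leqnSn n)) !atgt_acell tgt_src.
by rewrite -(asrc_src _ (leqnSn n)) !asrc_acell -pq.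
Qed.

Definition par_pair n (p q : X n.+2) (pq : tgt (src p) = src (src q)) : T X n.+2 :=
  exist _ _ (par_pair_pd pq).

Lemma par_pair_src n (p q : X n.+2) (pq : tgt (src p) = src (src q)) :
  src (par_pair pq) = pd_pair pq.
Proof.
apply: pdP => /=.
rewrite -[(acell p, _)]/(tcat (acell p, [::]) (acell (tgt (src p))) (acell q, [::])).
by rewrite pd_src_cat // !pd_src_solid //= !asrc_acell.
Qed.

Lemma par_pair_tgt n (p q : X n.+2) (pq : tgt (src p) = src (src q))
    (pq' : tgt (tgt p) = src (tgt q)) : tgt (par_pair pq) = pd_pair pq'.
Proof.
apply: pdP => /=.
rewrite -[(acell p, _)]/(tcat (acell p, [::]) (acell (tgt (src p))) (acell q, [::])).
by rewrite pd_tgt_cat // !pd_tgt_solid //= !atgt_acell /tcat /= tgt_src.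
Qed.
End PairDiagrams.

(** * Composition of pasting diagrams in codimension one *)

Section Composition.
Variable X : gset.

Lemma Tmu_eta n (u : T X n) : Tmu X n (Teta (T X) n u) = u.
Proof. exact: gmap_ap (mu_eta T_monad X) n u. Qed.

(** The composite of two (n+1)-diagrams along dimension n, as a gluing; its
    value is pd_comp n, so that the laws of a category are inherited. *)
Definition tcomp n (u v : T X n.+1) (uv : tgt u = src v) : T X n.+1 :=
  Tmu X n.+1 (pd_pair uv).

(** The diagram u seen in the next dimension, the identity of u. *)
Definition tid n (u : T X n) : T X n.+1 := Tmu X n.+1 (pd_deg u).

Lemma tidE n (u : T X n) : sval (tid u) = sval u.
Proof. by rewrite /= pd_flat_gl gl1. Qed.

(** Gluing composes along lower dimensions last; here the only bottom entry has
    dimension n, so all stages below n are trivial. *)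
Lemma tcompE n (u v : T X n.+1) (uv : tgt u = src v) :
  sval (tcomp uv) = pd_comp n (sval u) (sval v).
Proof.
have G k : k <= n -> gl (@pdval X) n.+1 0 (sval (pd_pair uv)) =
    gl (@pdval X) (n.+1 - k) k (sval (pd_pair uv)).
  elim: k => [|k IH] kn; first by rewrite subn0.
  rewrite IH; last exact: ltnW.
  have -> : n.+1 - k = (n.+1 - k.+1).+1 by lia.
  by rewrite gl_solid // /solid /= kn.
rewrite /= pd_flat_gl (G n) // subSn // subnn.
have -> : sval (pd_pair uv) = tcat (acell u, [::]) (acell (tgt u)) (acell v, [::]) by [].
by rewrite gl_cat //= !gl1.
Qed.

Lemma tcomp_eq n (u v u' v' : T X n.+1) (uv : tgt u = src v) (uv' : tgt u' = src v') :
  u = u' -> v = v' -> tcomp uv = tcomp uv'.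
Proof. by move=> eu ev; congr (Tmu X n.+1 _); apply: pair_eq. Qed.

Lemma tcomp_src n (u v : T X n.+1) (uv : tgt u = src v) : src (tcomp uv) = src u.
Proof. by rewrite /tcomp -(gfun_src (Tmu X)) pair_src Tmu_eta. Qed.
Lemma tcomp_tgt n (u v : T X n.+1) (uv : tgt u = src v) : tgt (tcomp uv) = tgt v.
Proof. by rewrite /tcomp -(gfun_tgt (Tmu X)) pair_tgt Tmu_eta. Qed.
Lemma tid_src n (u : T X n) : src (tid u) = u.
Proof. by rewrite /tid -(gfun_src (Tmu X)) deg_src Tmu_eta. Qed.
Lemma tid_tgt n (u : T X n) : tgt (tid u) = u.
Proof. by rewrite /tid -(gfun_tgt (Tmu X)) deg_tgt Tmu_eta. Qed.

Lemma tcpb n (u v : T X n.+1) : tgt u = src v -> cpb n (sval u) (sval v).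
Proof.
move=> e; have {e} : sval (tgt u) = sval (src v) by rewrite e.
by case: u v => [u [wu du]] [v [wv dv]].
Qed.

Lemma tcompA n (u v w : T X n.+1) (uv : tgt u = src v) (vw : tgt v = src w)
    (h1 : tgt (tcomp uv) = src w) (h2 : tgt u = src (tcomp vw)) :
  tcomp h1 = tcomp h2.
Proof. by apply: pdP; rewrite !tcompE compA //; apply: tcpb. Qed.

Lemma tcomp_idl n (u : T X n.+1) (h : tgt (tid (src u)) = src u) : tcomp h = u.
Proof.
apply: pdP; rewrite tcompE tidE; case: u h => u [wu du] h.
exact: comp_unitl.
Qed.
End Composition.

(** * Comparison of cells by cells of a set closed under pasting *)

Section Below.
Variables (P : cmc) (A : algebra P).

(** An instruction for the composite of two evaluated cells that remembers the
    composite diagram and has the boundary of the given cells.  The same holds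
    for identities with id_cell. *)
Definition comp_cell n (c d : P A n.+1) (cd : tgt c = src d) : P A n.+1 :=
  mu P A n.+1 (sec P (P A) n.+1 (pd_pair cd)).
Definition id_cell n (c : P A n) : P A n.+1 :=
  mu P A n.+1 (sec P (P A) n.+1 (pd_deg c)).

Lemma mu_sec_eta n (c : P A n) : mu P A n (sec P (P A) n (Teta (P A) n c)) = c.
Proof. by rewrite sec_eta; exact: gmap_ap (mu_eta P A) n c. Qed.

Lemma comp_cell_src n (c d : P A n.+1) (cd : tgt c = src d) : src (comp_cell cd) = src c.
Proof. by rewrite -!gfun_src pair_src mu_sec_eta. Qed.
Lemma comp_cell_tgt n (c d : P A n.+1) (cd : tgt c = src d) : tgt (comp_cell cd) = tgt d.
Proof. by rewrite -!gfun_tgt pair_tgt mu_sec_eta. Qed.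
Lemma id_cell_src n (c : P A n) : src (id_cell c) = c.
Proof. by rewrite -!gfun_src deg_src mu_sec_eta. Qed.
Lemma id_cell_tgt n (c : P A n) : tgt (id_cell c) = c.
Proof. by rewrite -!gfun_tgt deg_tgt mu_sec_eta. Qed.

Lemma ar_comp_cell n (c d : P A n.+1) (cd : tgt c = src d)
    (acd : tgt (ar P A n.+1 c) = src (ar P A n.+1 d)) :
  ar P A n.+1 (comp_cell cd) = tcomp acd.
Proof. by rewrite ar_mu ar_sec (Tmap_pair cd acd). Qed.
Lemma ar_id_cell n (c : P A n) : ar P A n.+1 (id_cell c) = tid (ar P A n c).
Proof. by rewrite ar_mu ar_sec Tmap_deg. Qed.

Lemma act_mu_sec n (U : T (P A) n) :
  act A n (mu P A n (sec P (P A) n U)) = eval A n (Tmap (act A) n U).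
Proof.
rewrite -[LHS]/((act A \og mu P A) n (sec P (P A) n U)) act_mu /=.
by rewrite sec_natural.
Qed.

Lemma act_comp_cell n (c d : P A n.+1) (cd : tgt c = src d)
    (acd : tgt (act A n.+1 c) = src (act A n.+1 d)) :
  compc acd = act A n.+1 (comp_cell cd).
Proof. by rewrite compcE act_mu_sec (Tmap_pair cd acd). Qed.
Lemma act_id_cell n (c : P A n) : idc (act A n c) = act A n.+1 (id_cell c).
Proof. by rewrite idcE act_mu_sec Tmap_deg. Qed.

Lemma compc_src n (x y : A n.+1) (xy : tgt x = src y) : src (compc xy) = src x.
Proof. by rewrite compcE -gfun_src pair_src eval_eta. Qed.
Lemma compc_tgt n (x y : A n.+1) (xy : tgt x = src y) : tgt (compc xy) = tgt y.
Proof. by rewrite compcE -gfun_tgt pair_tgt eval_eta. Qed.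
Lemma idc_tgt n (x : A n) : tgt (idc x) = x.
Proof. by rewrite idcE -gfun_tgt deg_tgt eval_eta. Qed.

Definition pst_closed (W : forall n, A n -> Prop) : Prop := forall n (c : P A n),
  (forall y, fdl (ar P A n c) y -> W n y) -> W n (act A n c).

Variable W : forall n, A n -> Prop.
Hypothesis W_act : pst_closed W.

(** A cell of W from x to y need not come with one from y to x, so this is only a
    preorder; that is enough, because the witnesses of invertibility point
    towards the identities. *)
Definition below n (x y : A n) : Prop :=
  exists p : A n.+1, [/\ src p = x, tgt p = y & W p].

(** The basic source of comparisons: fill a parallel pair of instructions by the
    contraction, with any diagram whose top-dimensional entries are in W. *)
Lemma below_fill n (c d : P A n) (w : T A n.+1) : parallel c d ->
  ar P A n c = src w -> ar P A n d = tgt w -> (forall y, fdl w y -> W y) ->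
  below (act A n c) (act A n d).
Proof.
move=> cd cw dw Ww; have [z [zc zd zw]] := contraction cd cw dw.
exists (act A n.+1 z); rewrite -gfun_src -gfun_tgt zc zd; split=> //.
by apply: W_act; rewrite zw.
Qed.

Lemma fdl_tid n (u : T A n) y : ~ fdl (tid u) y.
Proof.
rewrite /fdl tidE; have [_] := svalP u.
elim: (tops (sval u)) => [_ []|a l IH /andP[da dl]] /= [E|]; last exact: IH dl.
by move: da; rewrite E /= ltnn.
Qed.

(** An identity diagram has no top-dimensional entry, so coherence cells belong
    to every set closed under pasting. *)
Lemma below_coherence n (c d : P A n) : parallel c d -> ar P A n c = ar P A n d ->
  below (act A n c) (act A n d).
Proof.
move=> cd acd; apply: (@below_fill _ _ _ (tid (ar P A n c))) => //.
- by rewrite tid_src.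
- by rewrite tid_tgt.
- by move=> y /fdl_tid.
Qed.

Lemma W_eval n (u : T A n) : (forall y, fdl u y -> W y) -> W (eval A n u).
Proof. by move=> Wu; apply: W_act; rewrite ar_sec. Qed.

Lemma below_refl n (x : A n) : below x x.
Proof.
rewrite -(eval_eta x); apply: below_coherence => //; exact: parallel_refl.
Qed.

Lemma below_trans n (x y z : A n) : below x y -> below y z -> below x z.
Proof.
move=> [p [<- py Wp]] [q [qy <- Wq]]; have pq : tgt p = src q by rewrite py.
exists (compc pq); rewrite compc_src compc_tgt; split=> //.
rewrite compcE; apply: W_eval => t /= [|[|[]]] /acell_inj <- //.
Qed.

Lemma below_parallel n (x y : A n) : below x y -> parallel x y.
Proof. by case: n x y => // n x y [p [<- <- _]]; rewrite /= src_src tgt_src. Qed.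

Lemma below_comp n (x y x' y' : A n.+1) (xy : tgt x = src y) (xy' : tgt x' = src y') :
  below x x' -> below y y' -> below (compc xy) (compc xy').
Proof.
move=> bx yb; have [sx tx] := below_parallel bx; have [sy ty] := below_parallel yb.
case: bx yb => [p [px px' Wp]] [q [qy qy' Wq]].
have pq : tgt (src p) = src (src q) by rewrite px qy.
have pq' : tgt (tgt p) = src (tgt q) by rewrite px' qy'.
rewrite !compcE.
apply: (@below_fill _ (sec P A _ (pd_pair xy)) (sec P A _ (pd_pair xy')) (par_pair pq)).
- by split; [rewrite -!gfun_src !pair_src sx | rewrite -!gfun_tgt !pair_tgt ty].
- by rewrite ar_sec par_pair_src; apply: pair_eq.
- by rewrite ar_sec (par_pair_tgt _ pq'); apply: pair_eq.
- by move=> t /= [|[|[]]] /acell_inj <-.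
Qed.

(** Comparison of pasting diagrams through their standard composites. *)
Definition pd_below n (u v : T A n.+1) : Prop :=
  parallel u v /\ below (eval A n.+1 u) (eval A n.+1 v).

Lemma pd_below_refl n (u : T A n.+1) : pd_below u u.
Proof. by split; [exact: parallel_refl | exact: below_refl]. Qed.

Lemma pd_below_trans n (u v w : T A n.+1) : pd_below u v -> pd_below v w -> pd_below u w.
Proof.
move=> [[s t] uv] [[s' t'] vw]; split; last exact: below_trans vw.
by split; rewrite ?s ?t.
Qed.

(** Both cells evaluate the diagram tcomp uv, along parallel instructions. *)
Lemma eval_comp n (u v : T A n.+1) (uv : tgt u = src v)
    (euv : tgt (eval A n.+1 u) = src (eval A n.+1 v)) :
  below (eval A n.+1 (tcomp uv)) (compc euv) /\
  below (compc euv) (eval A n.+1 (tcomp uv)).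
Proof.
have suv : tgt (sec P A n.+1 u) = src (sec P A n.+1 v).
  by rewrite -gfun_tgt -gfun_src uv.
have auv : tgt (ar P A n.+1 (sec P A n.+1 u)) = src (ar P A n.+1 (sec P A n.+1 v)).
  by rewrite !ar_sec.
have E : ar P A n.+1 (sec P A n.+1 (tcomp uv)) = ar P A n.+1 (comp_cell suv).
  by rewrite ar_sec (ar_comp_cell suv auv); apply: tcomp_eq; rewrite ar_sec.
have [s t] : parallel (sec P A n.+1 (tcomp uv)) (comp_cell suv).
  split; first by rewrite comp_cell_src -!(gfun_src (sec P A)) tcomp_src.
  by rewrite comp_cell_tgt -!(gfun_tgt (sec P A)) tcomp_tgt.
rewrite (act_comp_cell suv euv); split; exact: below_coherence.
Qed.

Lemma pd_below_comp n (u v u' v' : T A n.+1) (uv : tgt u = src v)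
    (uv' : tgt u' = src v') :
  pd_below u u' -> pd_below v v' -> pd_below (tcomp uv) (tcomp uv').
Proof.
move=> [[su tu] bu] [[sv tv] bv]; split.
  by split; rewrite ?tcomp_src ?tcomp_tgt.
have euv : tgt (eval A n.+1 u) = src (eval A n.+1 v) by rewrite -gfun_tgt -gfun_src uv.
have euv' : tgt (eval A n.+1 u') = src (eval A n.+1 v').
  by rewrite -gfun_tgt -gfun_src uv'.
apply: below_trans (eval_comp uv euv).1 _.
apply: below_trans (eval_comp uv' euv').2.
exact: below_comp.
Qed.
End Below.

(** * Inverses of chains *)

Section Chains.
Variables (P : cmc) (A : algebra P) (W : forall n, A n -> Prop).
Hypothesis W_act : pst_closed W.
Local Notation pd_below := (@pd_below P A W _).
Local Notation below := (@below P A W _).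

Definition pd_cancel n (u v : T A n.+1) : Prop :=
  exists uv : tgt u = src v, pd_below (tcomp uv) (tid (src u)).

Lemma pd_cancel_tgt n (u v : T A n.+1) : pd_cancel u v -> tgt v = src u.
Proof. by case=> uv [[_]]; rewrite tcomp_tgt tid_tgt. Qed.

(** In the category of diagrams, (u v) (v' u') compares to u u' once v v'
    compares to an identity. *)
Lemma pd_cancel_comp n (u v u' v' : T A n.+1) (uv : tgt u = src v)
    (vu' : tgt v' = src u') :
  pd_cancel u u' -> pd_cancel v v' -> pd_cancel (tcomp uv) (tcomp vu').
Proof.
move=> Cu Cv; have tv := pd_cancel_tgt Cv; case: Cu Cv => uu Bu [vv Bv].
have h : tgt (tcomp uv) = src (tcomp vu') by rewrite tcomp_tgt tcomp_src.
exists h; rewrite tcomp_src.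
have h1 : tgt v = src (tcomp vu') by rewrite tcomp_src.
have h2 : tgt u = src (tcomp h1) by rewrite tcomp_src.
rewrite (tcompA h h2).
have h3 : tgt (tcomp vv) = src u' by rewrite tcomp_tgt.
have h4 : tgt u = src (tcomp h3) by rewrite !tcomp_src.
(* u (v (v' u')) = u ((v v') u') *)
have -> : tcomp h2 = tcomp h4 by apply: tcomp_eq => //; apply/esym/tcompA.
(* replace v v' by the identity of src v *)
have h5 : tgt (tid (src v)) = src u' by rewrite tid_tgt -uv.
have h6 : tgt u = src (tcomp h5) by rewrite tcomp_src tid_src.
apply: (pd_below_trans W_act (v := tcomp h6)).
  apply: (pd_below_comp W_act) => //; first exact: pd_below_refl.
  by apply: (pd_below_comp W_act) => //; apply: pd_below_refl.
have -> : tcomp h6 = tcomp uu => //.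
apply: tcomp_eq => //.
have h7 : tgt (tid (src u')) = src u' by rewrite tid_tgt.
rewrite -[RHS](tcomp_idl h7); apply: tcomp_eq => //.
by rewrite -uv uu.
Qed.

Definition pd_inverse n (u v : T A n.+1) : Prop := pd_cancel u v /\ pd_cancel v u.

(** For one-entry diagrams the comparison is literally the witness required in
    the definition of invertible cells. *)
Lemma pd_cancel_eta n (x y : A n.+1) (xy : tgt x = src y) :
  below (compc xy) (idc (src x)) -> pd_cancel (Teta A _ x) (Teta A _ y).
Proof.
move=> B; have exy : tgt (Teta A _ x) = src (Teta A _ y).
  by rewrite -gfun_tgt -gfun_src xy.
exists exy; have -> : tcomp exy = pd_pair xy.
  apply: pdP; by rewrite tcompE comp_high //= /tcat /= atgt_acell.
have -> : tid (src (Teta A _ x)) = pd_deg (src x).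
  by apply: pdP; rewrite tidE -gfun_src.
split; last by rewrite -compcE -idcE.
have := below_parallel B => -[_]; rewrite compc_tgt idc_tgt => E.
by split; rewrite ?pair_src ?pair_tgt ?deg_src ?deg_tgt // E.
Qed.

Lemma pd_inverse_eta n (x : A n.+1) : inv_step W x ->
  exists v, pd_inverse (Teta A n.+1 x) v.
Proof.
case=> y [xy [yx [B1 B2]]]; exists (Teta A n.+1 y); split.
  exact: pd_cancel_eta B1.
by apply: (@pd_cancel_eta _ _ _ yx); rewrite -xy.
Qed.

Lemma pd_inverse_comp n (u v u' v' : T A n.+1) (uv : tgt u = src v) :
  pd_inverse u u' -> pd_inverse v v' -> exists w, pd_inverse (tcomp uv) w.
Proof.
move=> [Cu Cu'] [Cv Cv'].
have vu : tgt v' = src u' by rewrite (pd_cancel_tgt Cv) -uv; case: Cu.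
by exists (tcomp vu); split; apply: pd_cancel_comp.
Qed.

(** A diagram without bottom entry of dimension below n is the composite of its
    top entries along dimension n. *)
Lemma chain_inverse n (u : atable A) (pu : is_pd n.+1 u) : solid n u ->
  n < adim (tfirst u) ->
  (forall y : A n.+1, List.In (acell y) (tops u) -> inv_step W y) ->
  exists v : T A n.+1, pd_inverse (exist _ u pu) v.
Proof.
elim/table_ind: u pu => [e|e b v IH] pu su hu I.
  have := pu; case=> _ /andP[de _].
  have {hu de} : adim e = n.+1 by apply/eqP; rewrite eqn_leq hu andbT.
  case: e pu su I => k x pu su I /= ek; subst k.
  have [v E] := pd_inverse_eta (I x (or_introl erefl)).
  by exists v; rewrite (_ : exist _ _ _ = Teta A n.+1 x) //; apply: pdP.
have := pu; case=> /wf_cat[_ L wv]; have := pu; case=> _.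
rewrite -[all _ _]/(dims_le _ _) dims_cat => /andP[de dv].
move: su; rewrite solid_cat => /and3P[_ nb sv].
have pv : is_pd n.+1 v by [].
have hv : n < adim (tfirst v) by case: L => _ lb _ _; apply: leq_ltn_trans lb.
have [v' Iv] : exists v', pd_inverse (exist _ v pv) v'.
  by apply: IH => // y yv; apply: I; rewrite tops_cat; right.
have {hu de} : adim e = n.+1.
  by apply/eqP; rewrite eqn_leq hu andbT; case/andP: de.
case: e pu L I => k x pu L I /= ek; subst k.
have [x' Ix] := pd_inverse_eta (I x (or_introl erefl)).
have bn : adim b = n.
  by case: L => /= lb _ _ _; apply/eqP; rewrite eqn_leq nb andbT -ltnS.
have [l1 l2 l3 l4] := L; rewrite bn in l3 l4.
have xv : tgt (Teta A n.+1 x) = src (exist _ v pv : T A n.+1).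
  apply: pdP; rewrite /= pd_tgt_solid // pd_src_solid //.
  by rewrite l4 -l3 /tlast.
have [w Iw] := pd_inverse_comp xv Ix Iv.
exists w; rewrite (_ : exist _ _ pu = tcomp xv) //; apply: pdP.
by rewrite tcompE comp_high //= /tlast /= l3.
Qed.
End Chains.

(** * Gluing without interaction across low-dimensional boundaries *)

Lemma amap_eta_inj (X : gset) : injective (amap (Teta X)).
Proof. by case=> i x [j y] /(congr1 (@pdval X)) []. Qed.

Lemma link_eta (X : gset) (a b c : anycell X) :
  pd_link (amap (Teta X) a) (amap (Teta X) b) (amap (Teta X) c) <-> pd_link a b c.
Proof.
rewrite /pd_link !adim_map atgt_map asrc_map.
by split=> -[ba bc ab cb]; split=> //; rewrite ?ab ?cb //; apply: amap_eta_inj.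
Qed.

Section Flat.
Variables (X : gset) (m : nat).
Implicit Types (U V : atable (T X)) (c : anycell (T X)).

(** Substitution of the entries without any merging.  The bottom entries are
    meant to be units, and tfirst (pdval _) recovers the cell of X. *)
Definition flat U : atable X :=
  tflatten (tmap (fun b => tfirst (pdval b)) (@pdval X) U).

(** A cell of TX whose boundary in dimension m is a single generator.  Entries
    of this kind cannot merge with their neighbours across a bottom entry of
    dimension below m. *)
Definition eta_bounded c : Prop := [/\ solid m (pdval c),
  asrc m c = amap (Teta X) (asrc m (tfirst (pdval c))) &
  atgt m c = amap (Teta X) (atgt m (tlast (pdval c)))].

Definition eta_bottom c : Prop := exists b, c = amap (Teta X) b /\ adim b < m.

Definition eta_table U : bool := all (fun c => `[< eta_bounded c >]) (tops U) &&
  all (fun p => `[< eta_bottom p.1 >]) U.2.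

Lemma eta_table_cat U b V :
  eta_table (tcat U b V) = [&& eta_table U, `[< eta_bottom b >] & eta_table V].
Proof.
rewrite /eta_table tops_cat all_cat [all _ (tcat U b V).2]all_cat andbACA; congr (_ && _).
exact: andbCA.
Qed.

Lemma eta_table1 c : eta_table (c, [::]) -> eta_bounded c.
Proof. by rewrite /eta_table /= !andbT => /asboolP. Qed.

Lemma eta_table_first U : eta_table U -> eta_bounded (tfirst U).
Proof. by case/andP=> /andP[/asboolP]. Qed.

Lemma eta_table_last U : eta_table U -> eta_bounded (tlast U).
Proof.
elim/table_ind: U => [c /eta_table1//|c b V IH].
by rewrite eta_table_cat tlast_cat => /and3P[_ _ /IH].
Qed.

Lemma flat1 c : flat (c, [::]) = pdval c.
Proof. by rewrite /flat /tflatten /= cats0; case: (pdval c). Qed.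

Lemma flat_cat U b V : flat (tcat U (amap (Teta X) b) V) = tcat (flat U) b (flat V).
Proof. by rewrite /flat tmap_cat tflatten_cat; case: b. Qed.

Lemma tfirst_flat U : tfirst (flat U) = tfirst (pdval (tfirst U)).
Proof. by []. Qed.

Lemma tlast_flat U : eta_table U -> tlast (flat U) = tlast (pdval (tlast U)).
Proof.
elim/table_ind: U => [c _|c b V IH]; first by rewrite flat1.
rewrite eta_table_cat => /and3P[_ /asboolP[a [-> _]] fV].
by rewrite flat_cat !tlast_cat IH.
Qed.

Lemma flat_solid i U : i <= m -> eta_table U -> solid i U -> solid i (flat U).
Proof.
move=> im; elim/table_ind: U => [c /eta_table1[s _ _] _|c b V IH].
  by rewrite flat1 (solid_le im s).
rewrite eta_table_cat => /and3P[fc /asboolP[a [-> am]] fV].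
rewrite !solid_cat flat_cat !solid_cat flat1 => /and3P[_ -> sV].
by rewrite IH //; case: (eta_table1 fc) => s _ _; rewrite (solid_le im s).
Qed.

Lemma link_flat U b V : eta_table U -> eta_table V -> adim b < m ->
  pd_link (tlast U) (amap (Teta X) b) (tfirst V) <->
  pd_link (tlast (flat U)) b (tfirst (flat V)).
Proof.
move=> fU fV bm; rewrite tlast_flat // tfirst_flat.
have [_ _ tU] := eta_table_last fU; have [_ sV _] := eta_table_first fV.
rewrite -(link_bd (tlast U) (tfirst V) (m := m)) // tU sV link_eta.
exact: link_bd.
Qed.

(** With entries of this kind the source is a diagram of generators, so that
    gluing leaves the boundary of an instruction alone by glue_eta. *)
Lemma flat_src U : eta_table U -> pd_src m U = atmap (Teta X) (pd_src m (flat U)).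
Proof.
elim/table_ind: U => [c /eta_table1[s e _]|c b V IH].
  by rewrite flat1 !pd_src_solid //= e.
rewrite eta_table_cat => /and3P[/eta_table1[s e _] /asboolP[a [-> am]] fV].
rewrite flat_cat flat1 !pd_src_cat // atmap_cat IH // (pd_src_solid s).
by rewrite pd_src_solid //= e.
Qed.

Lemma flat_tgt U : eta_table U -> pd_tgt m U = atmap (Teta X) (pd_tgt m (flat U)).
Proof.
elim/table_ind: U => [c /eta_table1[s _ e]|c b V IH].
  by rewrite flat1 (pd_tgt_solid s) pd_tgt_solid // [tlast (c, _)]/= e.
rewrite eta_table_cat => /and3P[/eta_table1[s _ e] /asboolP[a [-> am]] fV].
rewrite flat_cat flat1 !pd_tgt_cat // atmap_cat IH // (pd_tgt_solid s).
by rewrite pd_tgt_solid // [tlast (c, _)]/= e.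
Qed.

(** When every entry has a generator as boundary, each composition performed by
    the gluing is a plain juxtaposition of tables. *)
Lemma gl_flat d i U : good d i U -> eta_table U -> gl (@pdval X) d i U = flat U.
Proof.
elim: d i U => [|d IHd] i U G; first by rewrite (good0 G) gl1 flat1.
elim/(@block_ind (T X) i.+1): U G => [U sU G fU|U b V sU bi IH G].
  by rewrite gl_solid // IHd //; apply: goodS.
have [GU bE L GV] := good_cat G bi sU.
rewrite eta_table_cat => /and3P[fU /asboolP[a [E am]] fV].
rewrite gl_cat // (IH GV fV) (IHd _ _ (goodS GU sU) fU).
have GS := goodS GU sU; move: L GS sU bE bi G GU GV {IH}; rewrite {b}E.
rewrite -[adim (amap _ _)]/(adim a) => L GS sU bE _ _ GU GV; subst i.
case: ((link_flat fU fV am).1 L) => l1 l2 l3 l4.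
have [wU sa _] := GU; have [wV sV _] := GV.
have wF : wf (flat U).
  rewrite -(IHd _ _ GS fU); apply: gl_wf GS; [exact: pdval_wf | exact: pdval_src |].
  exact: pdval_tgt.
have sF := flat_solid (ltnW am) fU sa.
have sF' := flat_solid (ltnW am) fV sV.
have hF : adim a < adim (tfirst (flat U)) by rewrite solid_high.
by rewrite (comp_high sF sF' hF l2) flat_cat l3.
Qed.
End Flat.

(** * Rewriting all blocks of a diagram at once *)

Lemma In_cat (E : Type) (x : E) s t : List.In x (s ++ t) <-> List.In x s \/ List.In x t.
Proof. exact: List.in_app_iff. Qed.

Section Steps.
Variables (P : cmc) (A : algebra P) (W : forall n, A n -> Prop).
Hypothesis W_act : pst_closed W.
Variable m : nat.
Local Notation ev := (amap (eval A)).

Lemma ev_eta a : ev (amap (Teta A) a) = a.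
Proof. by case: a => i x; rewrite -[LHS]/(acell (eval A i (Teta A i x))) eval_eta. Qed.

(** u and v are presented as diagrams U and V of blocks with generators as
    boundaries, and w compares the standard composites of the blocks of U with
    those of V, all at once.  Comparisons of the values of two parts of a diagram
    that meet in a dimension k below m could not be combined directly: these
    values meet in the composite of a k-diagram, whereas blocks meet in the
    bottom entry between them. *)
Definition step (u v : atable A) : Prop :=
  exists (U V : atable (T A)) (w : atable A),
  [/\ is_pd m.+1 U, is_pd m.+1 V & is_pd m.+2 w] /\
  [/\ eta_table m U, eta_table m V, flat U = u & flat V = v] /\
  [/\ pd_src m.+1 w = atmap (eval A) U, pd_tgt m.+1 w = atmap (eval A) V &
      forall y : A m.+2, List.In (acell y) (tops w) -> W y].

Lemma is_pd_cat n (X : gset) (u v : atable X) b : is_pd n u -> is_pd n v ->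
  pd_link (tlast u) b (tfirst v) -> is_pd n (tcat u b v).
Proof.
move=> [wu du] [wv dv] L; split; first by apply/wf_cat.
by rewrite -[all _ _]/(dims_le _ _) dims_cat; apply/andP.
Qed.

(** Presentations are juxtaposed; in w the link is found by looking at the target
    on the left and at the source on the right. *)
Lemma step_cat u v b u' v' : step u v -> step u' v' -> adim b < m ->
  pd_link (tlast u) b (tfirst u') -> pd_link (tlast v) b (tfirst v') ->
  step (tcat u b u') (tcat v b v').
Proof.
move=> [U [V [w [[pU pV pw] [[fU fV <- <-] [sw tw Ww]]]]]].
move=> [U' [V' [w' [[pU' pV' pw'] [[fU' fV' <- <-] [sw' tw' Ww']]]]]] bm.
move=> /(link_flat fU fU' bm) L /(link_flat fV fV' bm) L'.
have bm1 : adim b < m.+1 by apply: ltnW.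
exists (tcat U (amap (Teta A) b) U'), (tcat V (amap (Teta A) b) V'), (tcat w b w').
have Q : `[< eta_bottom m (amap (Teta A) b) >] by apply/asboolP; exists b.
split; last split.
- split; try exact: is_pd_cat; apply: is_pd_cat => //.
  apply/(link_bd _ _ bm1); rewrite -tlast_tgt -tfirst_src tw sw' tlast_map tfirst_map.
  case: L L' => _ l2 _ l4 [l1' _ l3' _]; split; rewrite ?adim_map //.
    by rewrite atgt_map l3' ev_eta.
  by rewrite asrc_map l4 ev_eta.
- by rewrite !eta_table_cat !flat_cat fU fV fU' fV' Q.
- rewrite pd_src_cat // pd_tgt_cat // !atmap_cat ev_eta sw sw' tw tw'; split=> //.
  move=> y; rewrite tops_cat => /In_cat[|]; [exact: Ww | exact: Ww'].
Qed.

Lemma step_low a : adim a <= m -> step (a, [::]) (a, [::]).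
Proof.
move=> am; have F : eta_table m (amap (Teta A) a, [::]).
  have : eta_bounded m (amap (Teta A) a).
    by rewrite /eta_bounded asrc_map atgt_map; case: a am.
  by move=> B; rewrite /eta_table /= !andbT; apply/asboolP.
exists (amap (Teta A) a, [::]), (amap (Teta A) a, [::]), (a, [::]).
have am1 := leqW am; split; last split.
- by split; split=> //=; rewrite ?andbT ?adim_map // leqW.
- by rewrite !flat1; case: a am F am1.
have [-> ->] := pd_bd1 am1; rewrite /atmap /tmap /= ev_eta; split=> //.
by move=> y [E|//]; move: am1; rewrite E /= ltnn.
Qed.

Lemma eta_bounded_acell (u : T A m.+1) : solid m (sval u) ->
  m <= adim (tfirst (sval u)) -> eta_bounded m (acell u).
Proof.
move=> su hu; have E c : adim c = m -> forall v : T A m, sval v = (c, [::]) ->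
    acell v = amap (Teta A) c.
  by case: c => k x /= km; subst k => v Ev; congr acell; apply: pdP.
have wu : wf (sval u) by case: (svalP u).
split=> //; rewrite ?asrc_acell ?atgt_acell; apply: E.
- by rewrite adim_src; apply/minn_idPr.
- by rewrite /= pd_src_solid.
- rewrite adim_tgt; apply/minn_idPr.
  case: (solid_dim wu su) => [Eu|[_ /ltnW//]].
  by rewrite (congr1 (@tlast _ _) Eu).
- by rewrite /= pd_tgt_solid.
Qed.

(** A comparison of two chains is a step with a single block. *)
Lemma step_high (u v : T A m.+1) : solid m (sval u) -> solid m (sval v) ->
  m <= adim (tfirst (sval u)) -> m <= adim (tfirst (sval v)) -> pd_below W u v ->
  step (sval u) (sval v).
Proof.
move=> su sv hu hv [_ [p [pu pv Wp]]].
have F (c : T A m.+1) : solid m (sval c) -> m <= adim (tfirst (sval c)) ->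
    eta_table m (acell c, [::]).
  by move=> sc hc; rewrite /eta_table /= !andbT; apply/asboolP/eta_bounded_acell.
exists (acell u, [::]), (acell v, [::]), (acell p, [::]); split; last split.
- by split; exact: is_pd1.
- by rewrite !flat1; split=> //; apply: F.
- rewrite pd_src_solid // pd_tgt_solid // asrc_acell atgt_acell pu pv; split=> //.
  by move=> y [/acell_inj <-|//].
Qed.

(** The cells c and d are replaced, up to coherence, by instructions g and h for
    the presentations U and V with boundary the image of that of c under the
    unit; these are compared by filling with w. *)
Lemma step_below (u v : T A m.+1) (c d : P A m.+1) : step (sval u) (sval v) ->
  parallel c d -> ar P A m.+1 c = u -> ar P A m.+1 d = v ->
  below W (act A m.+1 c) (act A m.+1 d).
Proof.
move=> [U [V [w [[pU pV pw] [[fU fV Uu Vv] [sw tw Ww]]]]]] [scd tcd] cu dv.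
pose U' : T (T A) m.+1 := exist _ U pU; pose V' : T (T A) m.+1 := exist _ V pV.
pose w' : T A m.+2 := exist _ w pw.
have par : parallel (fmap P (Teta A) m (src c)) (fmap P (Teta A) m (tgt c)).
  exact/parallel_gmap/parallel_src_tgt.
have lift (Z : T (T A) m.+1) (e : P A m.+1) : eta_table m (sval Z) ->
    flat (sval Z) = sval (ar P A m.+1 e) -> src e = src c -> tgt e = tgt c ->
    exists g : P (T A) m.+1, [/\ src g = fmap P (Teta A) m (src c),
      tgt g = fmap P (Teta A) m (tgt c), ar P (T A) m.+1 g = Z &
      ar P A m.+1 (glue A m.+1 g) = ar P A m.+1 e].
  move=> fZ Ze se te.
  have E1 : ar P (T A) m (fmap P (Teta A) m (src c)) = src Z.
    by rewrite -se ar_natural gfun_src; apply: pdP; rewrite /= flat_src // Ze.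
  have E2 : ar P (T A) m (fmap P (Teta A) m (tgt c)) = tgt Z.
    by rewrite -te ar_natural gfun_tgt; apply: pdP; rewrite /= flat_tgt // Ze.
  have [g [gs gt gZ]] := contraction par E1 E2.
  exists g; split=> //; rewrite ar_glue gZ; apply: pdP.
  by rewrite -Ze -(gl_flat (good_pd (svalP Z)) fZ).
have [|g [gs gt gU gu]] := lift U' c fU _ erefl erefl; first by rewrite cu.
have [|h [hs ht hV hv]] := lift V' d fV _ (esym scd) (esym tcd); first by rewrite dv.
apply: (below_trans W_act (y := act A m.+1 (fmap P (eval A) m.+1 g))).
  rewrite act_glue; apply: (below_coherence W_act) => //.
  by split; rewrite -?gfun_src -?gfun_tgt ?gs ?gt glue_eta.
apply: (below_trans W_act (y := act A m.+1 (fmap P (eval A) m.+1 h))).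
  apply: (below_fill W_act (w := w')) => //.
  - by apply: parallel_gmap; split; rewrite ?gs ?hs ?gt ?ht.
  - by rewrite ar_natural gU; apply: pdP; rewrite /= sw.
  - by rewrite ar_natural hV; apply: pdP; rewrite /= tw.
rewrite act_glue; apply: (below_coherence W_act) => //.
by split; rewrite -?gfun_src -?gfun_tgt ?hs ?ht glue_eta.
Qed.

Definition table_inverse (u v : atable A) : Prop :=
  [/\ is_pd m.+1 v, pd_tgt m u = pd_src m v & pd_tgt m v = pd_src m u] /\
  step (pd_comp m u v) (pd_src m u) /\ step (pd_comp m v u) (pd_tgt m u).

(** Either u is a single entry of dimension at most m, hence an identity, or it is
    a chain of (m+1)-cells. *)
Lemma solid_inverse (u : atable A) : is_pd m.+1 u -> solid m u ->
  (forall y : A m.+1, List.In (acell y) (tops u) -> inv_step W y) ->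
  exists v, table_inverse u v.
Proof.
move=> pu su I; have [wu du] := pu.
case: (solid_low wu su) => [lu|hu].
  have E := solid_dims wu su lu; have am := dims_first lu.
  have [bs bt] := pd_bd1 am; have c0 : cpb m u u by rewrite E; split; rewrite ?bs ?bt.
  exists u; rewrite /table_inverse (comp_unitl' c0 lu) pd_src_id // pd_tgt_id //.
  by have := step_low am; rewrite -E.
have [v [[uv Buv] [vu Bvu]]] := chain_inverse W_act pu su hu I.
set u' : T A m.+1 := exist _ u pu in uv vu Buv Bvu.
have e1 : pd_tgt m u = pd_src m (sval v) := congr1 (fun w : T A m => sval w) uv.
have e2 : pd_tgt m (sval v) = pd_src m u := congr1 (fun w : T A m => sval w) vu.
have sv : solid m (sval v) by rewrite -(solid_src _ (leqnn m)) -e1 solid_tgt.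
have low c : adim c = m -> m <= adim c by move=> ->.
have dsu : adim (tfirst (pd_src m u)) = m.
  by rewrite tfirst_src adim_src; apply/minn_idPr/ltnW.
have dtu : adim (tfirst (pd_tgt m u)) = m.
  rewrite pd_tgt_solid //= adim_tgt; apply/minn_idPr/ltnW.
  by rewrite -solid_high.
have first_le (w : atable A) k : adim (tfirst (pd_src m w)) = k -> m <= k ->
    m <= adim (tfirst w).
  by rewrite tfirst_src adim_src => <-; rewrite leq_min => /andP[].
exists (sval v); split; first by split=> //; exact: svalP v.
have [_ cs1 ct1] := comp_bd (tcpb uv); have [_ cs2 ct2] := comp_bd (tcpb vu).
split.
  rewrite -[u]/(sval u') -(tcompE uv) -[pd_src _ _]/(sval (src u')) -(tidE (src u')).
  apply: step_high => //; rewrite ?tcompE ?tidE.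
  - by rewrite (comp_solid _ (tcpb uv)).
  - by rewrite /= solid_src.
  - by apply: (first_le _ m) => //; rewrite cs1.
  - exact: low.
rewrite -[u]/(sval u') -(tcompE vu) -[pd_tgt _ _]/(sval (tgt u')) -(tidE (tgt u')).
have E : tgt u' = src v by [].
apply: step_high => //; rewrite ?tcompE ?tidE.
- by rewrite (comp_solid _ (tcpb vu)).
- by rewrite /= solid_tgt.
- by apply: (first_le _ m) => //; rewrite cs2 -e1.
- exact: low.
- by rewrite E.
Qed.

(** The inverse of a diagram reverses every block separately. *)
Lemma table_inverseP (u : atable A) : is_pd m.+1 u ->
  (forall y : A m.+1, List.In (acell y) (tops u) -> inv_step W y) ->
  exists v, table_inverse u v.
Proof.
elim/(@block_ind A m): u => [u su pu I|u b v su bm IH].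
  exact: solid_inverse.
move=> [/wf_cat[wu L wv]]; rewrite -[all _ _]/(dims_le _ _) dims_cat.
move=> /andP[du dv] I.
have [u' [[pu' tu su'] [S1 S2]]] : exists u', table_inverse u u'.
  apply: solid_inverse => // y yu; apply: I; rewrite tops_cat.
  by apply/In_cat; left.
have [v' [[pv' tv sv'] [S3 S4]]] : exists v', table_inverse v v'.
  apply: IH => // y yu; apply: I; rewrite tops_cat.
  by apply/In_cat; right.
have L' : pd_link (tlast u') b (tfirst v').
  apply/(link_bd _ _ bm); rewrite -tlast_tgt -tfirst_src su' -tv.
  have wuv : wf (tcat u b v) by apply/wf_cat.
  have := wf_src m wuv; rewrite pd_src_cat // => /wf_cat[_ [l1 _ l3 _] _].
  by have := wf_tgt m wuv; rewrite pd_tgt_cat // => /wf_cat[_ [_ l2 _ l4] _].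
have [wu' _] := pu'; have [wv' _] := pv'.
have cu : cpb m u u' by []. have cu' : cpb m u' u by [].
have cv : cpb m v v' by []. have cv' : cpb m v' v by [].
have wc x x' y y' : cpb m x x' -> cpb m y y' -> pd_link (tlast x) b (tfirst y) ->
    pd_link (tlast x') b (tfirst y') -> step (pd_comp m x x') (pd_src m x) ->
    step (pd_comp m y y') (pd_src m y) ->
    step (pd_comp m (tcat x b y) (tcat x' b y')) (pd_src m (tcat x b y)).
  move=> cx cy Lx Ly Sx Sy; rewrite pd_comp_cat ?(cpb_size cx) // pd_src_cat //.
  have [wx wx' ex] := cx; have [wy wy' ey] := cy.
  have wz : wf (tcat x b y) by apply/wf_cat.
  have wz' : wf (tcat x' b y') by apply/wf_cat.
  have cz : cpb m (tcat x b y) (tcat x' b y').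
    by split=> //; rewrite pd_tgt_cat // pd_src_cat // ex ey.
  apply: step_cat => //.
  - by have [+ _ _] := comp_bd cz; rewrite pd_comp_cat ?(cpb_size cx) // => /wf_cat[].
  - by have := wf_src m wz; rewrite pd_src_cat // => /wf_cat[].
exists (tcat u' b v'); split; first split.
- exact: is_pd_cat.
- by rewrite pd_tgt_cat // pd_src_cat // tu tv.
- by rewrite pd_tgt_cat // pd_src_cat // su' sv'.
split; first exact: wc.
have -> : pd_tgt m (tcat u b v) = pd_src m (tcat u' b v').
  by rewrite pd_tgt_cat // pd_src_cat // tu tv.
by apply: wc => //; rewrite -?tu -?tv.
Qed.
End Steps.

(** * Inverses of composite cells and the coinduction *)

(** The passage from a cancellation of diagrams to a witness of invertibility,
    used for both orders of composition. *)
Lemma cell_cancel (P : cmc) (A : algebra P) (W : forall n, A n -> Prop) m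
    (c d : P A m.+1) (cd : tgt (act A m.+1 c) = src (act A m.+1 d)) :
  pst_closed W ->
  tgt c = src d -> tgt d = src c ->
  step W m (pd_comp m (sval (ar P A _ c)) (sval (ar P A _ d)))
    (pd_src m (sval (ar P A _ c))) ->
  below W (compc cd) (idc (src (act A m.+1 c))).
Proof.
move=> W_act tc td S.
have acd : tgt (ar P A m.+1 c) = src (ar P A m.+1 d) by rewrite -gfun_tgt -gfun_src tc.
rewrite (act_comp_cell tc) -gfun_src act_id_cell.
apply: (step_below W_act _ _ (ar_comp_cell tc acd) (ar_id_cell (src c))).
  by rewrite tcompE tidE gfun_src.
by split; rewrite ?comp_cell_src ?comp_cell_tgt ?id_cell_src ?id_cell_tgt.
Qed.

Section Closure.
Variables (P : cmc) (A : algebra P).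

(** One application of pst need not give a set closed under pasting: the values
    of two instructions may be composable without the instructions being so.
    Hence the iteration. *)
Inductive pst_closure : forall n, A n -> Prop :=
| pst_closure_inv n (x : A n) : invertible x -> pst_closure x
| pst_closure_act n (c : P A n) :
    (forall y, fdl (ar P A n c) y -> pst_closure y) -> pst_closure (act A n c).

(** The inverse of act c is the value of an instruction d in the opposite
    direction over the inverse diagram; d exists by the contraction. *)
Lemma act_inverse n (c : P A n) :
  (forall y, fdl (ar P A n c) y -> inv_step pst_closure y) ->
  inv_step pst_closure (act A n c).
Proof.
case: n c => [|m] c I.
  (* In dimension 0 the first entry is a 0-cell, and no 0-cell is invertible. *)
  case: (svalP (ar P A 0 c)) => _ /andP[]; move: I; rewrite /fdl /tops.
  by case: (sval _).1 => -[|k] x // I _ _; apply: (I x); left.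
have [v [[pv uv vu] [S1 S2]]] := table_inverseP pst_closure_act (svalP (ar P A m.+1 c)) I.
have [d [ds dt dv]] : exists d : P A m.+1,
    [/\ src d = tgt c, tgt d = src c & ar P A m.+1 d = exist _ v pv].
  apply: contraction.
  - by case: (m) (c) => // k c'; split; rewrite ?src_src ?tgt_src.
  - by rewrite gfun_tgt; apply: pdP.
  - by rewrite gfun_src; apply: pdP.
have cd : tgt (act A m.+1 c) = src (act A m.+1 d) by rewrite -gfun_tgt -gfun_src ds.
have dc : tgt (act A m.+1 d) = src (act A m.+1 c) by rewrite -gfun_tgt -gfun_src dt.
exists (act A m.+1 d), cd, dc; split.
  by apply: (cell_cancel cd (@pst_closure_act)) => //; rewrite dv.
rewrite cd; apply: (cell_cancel dc (@pst_closure_act)) => //.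
by rewrite dv /= -uv.
Qed.

Lemma inv_step_mono (S S' : forall n, A n -> Prop) n (x : A n) :
  (forall k (y : A k), S k y -> S' k y) -> inv_step S x -> inv_step S' x.
Proof.
move=> SS; case: n x => // n x [y [xy [yx [[p [sp tp Sp]] [q [sq tq Sq]]]]]].
by exists y, xy, yx; split; [exists p | exists q]; split=> //; apply: SS.
Qed.

Lemma pst_closure_invertible n (x : A n) : pst_closure x -> invertible x.
Proof.
move=> Cx; exists (@pst_closure); split=> // k y.
elim=> {Cx x n k y} [n x [S [SI Sx]] | n c _]; last exact: act_inverse.
apply: inv_step_mono (SI _ _ Sx) => k y Sy; apply: pst_closure_inv.
by exists S.
Qed.
End Closure.

Theorem theorem3p3p7 (L : cmc) (hL : is_initial L) (A : algebra L)
    (n : nat) (x : A n) :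
  pst (@invertible L A) x -> invertible x.
Proof.
move=> [phi [u [h [I ->]]]]; apply: pst_closure_invertible; apply: pst_closure_act.
by have [_ ->] := pcell_spec h => y /I; apply: pst_closure_inv.
Qed.
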